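(* Let $2<n<\omega$. There is a countable, atomic and complete $L_n$ theory $T$ such that the non-principal type consisting of the co-atoms of $T$ cannot be omitted in any $(n+3)$-square model of $T$, and a fortiori cannot be omitted in any $(n+3)$-flat model of $T$.
   Context: $L_n$ is first-order logic (with equality) restricted to the first $n$ variables. For an $L_n$ theory $T$, $\mathfrak{Fm}_T$ is the Tarski–Lindenbaum quotient algebra of $L_n$-formulas modulo semantical equivalence with respect to $T$; it is a representable cylindric algebra of dimension $n$, with $\mathsf c_i$ given by $\exists x_i$ and $\mathsf d_{ij}$ by $x_i=x_j$. $T$ is atomic if $\mathfrak{Fm}_T$ is atomic (every non-zero element is above an atom). A co-atom of $T$ is a formula $\phi$ such that the class of $\neg\phi$ is an atom of $\mathfrak{Fm}_T$. A set $\Gamma$ of $L_n$-formulas is a non-principal type if the infimum in $\mathfrak{Fm}_T$ of the classes of its members is $0$. Let $2<n\le m<\omega$ and let $\mathfrak A=\mathfrak{Fm}_T$. A relativized representation of $\mathfrak A$ with base $M$ is an injective homomorphism $f:\mathfrak A\to\wp(V)$, where $V=f(1)\subseteq{}^nM$, $M=\bigcup_{s\in V}\mathrm{rng}(s)$, and $\wp(V)$ carries the Boolean operations, $\mathsf C_iX=\{s\in V:\exists t\in X,\ t(j)=s(j)\ \forall j\neq i\}$ and $\mathsf D_{ij}=\{s\in V:s_i=s_j\}$. Write $M\models a(s)$ for $s\in f(a)$. An $n$-clique is a set $C\subseteq M$ such that $(a_1,\dots,a_n)\in V$ for all distinct $a_1,\dots,a_n\in C$; $\mathsf C^m(M)=\{s\in{}^mM:\mathrm{rng}(s)\text{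 is an }n\text{-clique}\}$. $M$ is an $m$-square representation if for all $\bar s\in\mathsf C^m(M)$, $a\in\mathfrak A$, $i<n$ and injective $l:n\to m$, whenever $M\models\mathsf c_ia(s_{l(0)},\dots,s_{l(n-1)})$ there is $\bar t\in\mathsf C^m(M)$ agreeing with $\bar s$ off $l(i)$ such that $M\models a(t_{l(0)},\dots,t_{l(n-1)})$. Let $L(\mathfrak A)^m$ be the first-order language with $m$ variables and one $n$-ary relation symbol for each element of $\mathfrak A$. The clique-guarded semantics $\models_c$ at $\bar s\in\mathsf C^m(M)$ is as usual for atomic formulas and Boolean connectives, and $M,\bar s\models_c\exists x_i\phi$ iff there is $\bar t\in\mathsf C^m(M)$ agreeing with $\bar s$ off $i$ with $M,\bar t\models_c\phi$. $M$ is $m$-flat if it is $m$-square and for all $\phi\in L(\mathfrak A)^m$, $\bar s\in\mathsf C^m(M)$ and distinct $i,j<m$, $M,\bar s\models_c\exists x_i\exists x_j\phi\leftrightarrow\exists x_j\exists x_i\phi$. An $m$-square (respectively $m$-flat) model of $T$ is an $m$-square (respectively $m$-flat) representation $f$ of $\mathfrak{Fm}_T$. It omits $\Gamma$ if $\bigcap_{\phi\in\Gamma}f(\phi/{\equiv_T})=\emptyset$. *)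

(* Defs.v *)
From HB Require Import structures.
From mathcomp Require Import all_boot all_order all_classical.
Set Implicit Arguments.
Unset Strict Implicit.
Unset Printing Implicit Defensive.
Import Order.TTheory.
Local Open Scope classical_set_scope.

Record signature := Signature { symb : Type; arity : symb -> nat }.

(* Only n variables, whether bound or free; they may occur in any order and
   with repetitions in an atomic formula. *)
Inductive formula (L : signature) (n : nat) : Type :=
| Eq of 'I_n & 'I_n
| Rel (R : symb L) of {ffun 'I_(arity R) -> 'I_n}
| Bot
| Not of formula L n
| And of formula L n & formula L n
| Or of formula L n & formula L n
| Ex of 'I_n & formula L n.
Arguments Eq {L n}.
Arguments Rel {L n}.
Arguments Bot {L n}.
Arguments Not {L n}.
Arguments And {L n}.
Arguments Or {L n}.
Arguments Ex {L n}.

Fixpoint free_vars L n (p : formula L n) : {set 'I_n} :=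
  match p with
  | Eq i j => [set i; j]
  | Rel R xs => [set xs k | k : 'I_(arity R)]
  | Bot => finset.set0
  | Not q => free_vars q
  | And q r | Or q r => free_vars q :|: free_vars r
  | Ex i q => free_vars q :\ i
  end%SET.

Definition sentence L n (p : formula L n) := free_vars p = finset.set0.

Record structure (L : signature) := Structure {
  dom :> Type;
  dom_inhabited : inhabited dom;
  interp : forall R : symb L, ('I_(arity R) -> dom) -> Prop }.

Definition agree_off (k : nat) (D : Type) (i : 'I_k) (s t : 'I_k -> D) :=
  forall j, j != i -> t j = s j.

Fixpoint sat L n (M : structure L) (s : 'I_n -> M) (p : formula L n) : Prop :=
  match p with
  | Eq i j => s i = s j
  | Rel R xs => interp (s \o xs)
  | Bot => False
  | Not q => ~ sat s q
  | And q r => sat s q /\ sat s r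
  | Or q r => sat s q \/ sat s r
  | Ex i q => exists2 t, agree_off i s t & sat t q
  end.

Definition theory L n := set (formula L n).

Definition model_of L n (T : theory L n) (M : structure L) :=
  forall p, T p -> forall s : 'I_n -> M, sat s p.

Definition entails L n (T : theory L n) (p : formula L n) :=
  forall M, model_of T M -> forall s : 'I_n -> M, sat s p.

Definition complete_theory L n (T : theory L n) :=
  [/\ T `<=` @sentence L n,
      exists M, model_of T M
    & forall p, sentence p -> entails T p \/ entails T (Not p)].

(* A countable theory is understood to be in a countable language. *)
Definition countable_theory L n (T : theory L n) :=
  countable [set: symb L] /\ countable T.

(* The axioms C1-C7 of Henkin, Monk and Tarski. *)
HB.mixin Record isCylindric (n : nat) d A of Order.CTBDistrLattice d A := {
  cyl : 'I_n -> A -> A;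
  diag : 'I_n -> 'I_n -> A;
  cyl_bot : forall i, cyl i \bot%O = \bot%O;
  cyl_ge : forall i (x : A), (x <= cyl i x)%O;
  cyl_meet : forall i (x y : A),
    cyl i (x `&` cyl i y)%O = (cyl i x `&` cyl i y)%O;
  cylC : forall i j (x : A), cyl i (cyl j x) = cyl j (cyl i x);
  diag_refl : forall i, diag i i = \top%O;
  diag_cyl : forall i j k, k != i -> k != j ->
    diag i j = cyl k (diag i k `&` diag k j)%O;
  diag_sep : forall i j (x : A), i != j ->
    (cyl i (diag i j `&` x) `&` cyl i (diag i j `&` ~` x) = \bot)%O }.

#[short(type="cylindricType")]
HB.structure Definition Cylindric (n : nat) d :=
  { A of isCylindric n d A & Order.CTBDistrLattice d A }.

Definition atom d (A : ctbDistrLatticeType d) (a : A) :=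
  a <> \bot%O /\ forall b : A, (b <= a)%O -> b = \bot%O \/ b = a.

Definition atomic d (A : ctbDistrLatticeType d) :=
  forall x : A, x <> \bot%O -> exists2 a : A, atom a & (a <= x)%O.

HB.instance Definition _ L n := gen_eqMixin (formula L n).
HB.instance Definition _ L n := gen_choiceMixin (formula L n).

Section TarskiLindenbaum.
Variables (L : signature) (n : nat) (T : theory L n).
Implicit Types p q : formula L n.
Local Open Scope quotient_scope.

Definition sem_equiv p q :=
  forall M, model_of T M -> forall s : 'I_n -> M, sat s p <-> sat s q.

Definition sem_equivb p q := `[< sem_equiv p q >].

Let sem_equivb_refl : reflexive sem_equivb.
Proof. by move=> p; apply/asboolP. Qed.

Let sem_equivb_sym : symmetric sem_equivb.
Proof.
by move=> p q; apply/asboolP/asboolP => h M hM s; have := h M hM s; tauto.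
Qed.

Let sem_equivb_trans : transitive sem_equivb.
Proof.
move=> q p r /asboolP h1 /asboolP h2; apply/asboolP => M hM s.
by have := h1 M hM s; have := h2 M hM s; tauto.
Qed.

Canonical sem_equiv_rel :=
  EquivRel sem_equivb sem_equivb_refl sem_equivb_sym sem_equivb_trans.

Definition Fm := {eq_quot sem_equiv_rel}.
HB.instance Definition _ := Choice.on Fm.

Definition Fm_class p : Fm := \pi_Fm p.

Lemma Fm_classP p q : Fm_class p = Fm_class q <-> sem_equiv p q.
Proof.
by split => [/eqmodP/asboolP //|h]; apply/eqmodP/asboolP.
Qed.

Lemma Fm_classK (x : Fm) : Fm_class (repr x) = x.
Proof. exact: reprK. Qed.

Lemma sat_repr (M : structure L) p (s : 'I_n -> M) :
  model_of T M -> sat s (repr (Fm_class p)) <-> sat s p.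
Proof. by move=> hM; apply: (Fm_classP _ _).1 => //; rewrite Fm_classK. Qed.

Let ext (x y : Fm) :
  (forall M, model_of T M -> forall s : 'I_n -> M,
     sat s (repr x) <-> sat s (repr y)) -> x = y.
Proof. by move=> h; rewrite -(Fm_classK x) -(Fm_classK y); apply/Fm_classP. Qed.

Definition Fm_bot := Fm_class Bot.
Definition Fm_top := Fm_class (Not Bot).
Definition Fm_compl (x : Fm) := Fm_class (Not (repr x)).
Definition Fm_meet (x y : Fm) := Fm_class (And (repr x) (repr y)).
Definition Fm_join (x y : Fm) := Fm_class (Or (repr x) (repr y)).
Definition Fm_cyl i (x : Fm) := Fm_class (Ex i (repr x)).
Definition Fm_diag i j := Fm_class (Eq i j).
Definition Fm_le (x y : Fm) := Fm_meet x y == x.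
Definition Fm_lt (x y : Fm) := (y != x) && Fm_le x y.

Let sat_bot (M : structure L) (s : 'I_n -> M) : model_of T M -> sat s (repr Fm_bot) <-> False.
Proof. exact: sat_repr. Qed.
Let sat_top (M : structure L) (s : 'I_n -> M) : model_of T M -> sat s (repr Fm_top) <-> True.
Proof. by move=> hM; rewrite sat_repr //=; tauto. Qed.
Let sat_compl (M : structure L) (s : 'I_n -> M) x : model_of T M ->
  sat s (repr (Fm_compl x)) <-> ~ sat s (repr x).
Proof. exact: sat_repr. Qed.
Let sat_meet (M : structure L) (s : 'I_n -> M) x y : model_of T M ->
  sat s (repr (Fm_meet x y)) <-> sat s (repr x) /\ sat s (repr y).
Proof. exact: sat_repr. Qed.
Let sat_join (M : structure L) (s : 'I_n -> M) x y : model_of T M ->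
  sat s (repr (Fm_join x y)) <-> sat s (repr x) \/ sat s (repr y).
Proof. exact: sat_repr. Qed.
Let sat_cyl (M : structure L) (s : 'I_n -> M) i x : model_of T M ->
  sat s (repr (Fm_cyl i x)) <-> exists2 t, agree_off i s t & sat t (repr x).
Proof. exact: sat_repr. Qed.
Let sat_diag (M : structure L) (s : 'I_n -> M) i j : model_of T M ->
  sat s (repr (Fm_diag i j)) <-> s i = s j.
Proof. exact: sat_repr. Qed.

Let satE := (sat_bot, sat_top, sat_compl, sat_meet, sat_join).

Ltac boole := apply: ext => M hM s; rewrite ?satE //; tauto.

Let meetC : commutative Fm_meet. Proof. by move=> x y; boole. Qed.
Let joinC : commutative Fm_join. Proof. by move=> x y; boole. Qed.
Let meetA : associative Fm_meet. Proof. by move=> x y z; boole. Qed.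
Let joinA : associative Fm_join. Proof. by move=> x y z; boole. Qed.
Let joinKI y x : Fm_meet x (Fm_join x y) = x. Proof. by boole. Qed.
Let meetKU y x : Fm_join x (Fm_meet x y) = x. Proof. by boole. Qed.
Let meetUl : left_distributive Fm_meet Fm_join.
Proof. by move=> x y z; boole. Qed.
Let meetxx : idempotent_op Fm_meet. Proof. by move=> x; boole. Qed.

Fact Fm_display : Order.disp_t. Proof. exact: Order.Disp tt tt. Qed.

HB.instance Definition _ := Order.isMeetJoinDistrLattice.Build Fm_display Fm
  (fun _ _ => erefl) (fun _ _ => erefl)
  meetC joinC meetA joinA joinKI meetKU meetUl meetxx.

Let le0x x : (Fm_bot <= x :> Fm)%O. Proof. by apply/eqP; boole. Qed.
Let lex1 x : (x <= Fm_top :> Fm)%O. Proof. by apply/eqP; boole. Qed.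
HB.instance Definition _ := Order.hasBottom.Build Fm_display Fm le0x.
HB.instance Definition _ := Order.hasTop.Build Fm_display Fm lex1.

Let joinxN (x : Fm) : Fm_join x (Fm_compl x) = Fm_top.
Proof. by apply: ext => M hM s; rewrite !satE //; have := EM (sat s (repr x)); tauto. Qed.
Let meetxN (x : Fm) : Fm_meet x (Fm_compl x) = Fm_bot. Proof. by boole. Qed.
HB.instance Definition _ := Order.TBDistrLattice_hasComplement.Build Fm_display Fm
  joinxN meetxN.

Let c_bot i : Fm_cyl i \bot%O = \bot%O.
Proof.
apply: ext => M hM s; rewrite sat_cyl // sat_bot //.
by split=> // -[t _]; rewrite sat_bot.
Qed.

Let c_ge i (x : Fm) : (x <= Fm_cyl i x)%O.
Proof.
apply/eqP; apply: ext => M hM s; rewrite sat_meet // sat_cyl //.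
by split=> [[]//|h]; split=> //; exists s.
Qed.

Let c_meet i (x y : Fm) :
  Fm_cyl i (x `&` Fm_cyl i y)%O = (Fm_cyl i x `&` Fm_cyl i y)%O.
Proof.
apply: ext => M hM s; rewrite sat_meet // !sat_cyl //; split.
  move=> [t st]; rewrite sat_meet // sat_cyl // => -[tx [u tu uy]].
  split; first by exists t.
  by exists u => // j ji; rewrite tu // st.
move=> [[t st tx] [u su uy]]; exists t => //; rewrite sat_meet // sat_cyl //.
by split=> //; exists u => // j ji; rewrite st // su.
Qed.

Let cC i j (x : Fm) : Fm_cyl i (Fm_cyl j x) = Fm_cyl j (Fm_cyl i x).
Proof.
suff H k l (M : structure L) (hM : model_of T M) (s : 'I_n -> M) :
    sat s (repr (Fm_cyl k (Fm_cyl l x))) ->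
    sat s (repr (Fm_cyl l (Fm_cyl k x))).
  by apply: ext => M hM s; split; apply: H.
rewrite sat_cyl // => -[t st]; rewrite sat_cyl // => -[u tu ux].
have [kl|kl] := eqVneq k l.
  by subst l; rewrite sat_cyl //; exists t => //; rewrite sat_cyl //; exists u.
rewrite sat_cyl //; exists (fun a => if a == l then u l else s a).
  by move=> a /negbTE ->.
rewrite sat_cyl //; exists u => // a ak.
by have [->|al] := eqVneq a l; rewrite // tu // st.
Qed.

Let d_refl i : Fm_diag i i = \top%O.
Proof. by apply: ext => M hM s; rewrite sat_diag // sat_top. Qed.

Let d_cyl i j k : k != i -> k != j ->
  Fm_diag i j = Fm_cyl k (Fm_diag i k `&` Fm_diag k j)%O.
Proof.
move=> ki kj; apply: ext => M hM s; rewrite sat_diag // sat_cyl //; split.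
  move=> e; exists (fun a => if a == k then s i else s a).
    by move=> a /negbTE ->.
  rewrite sat_meet // !sat_diag // eqxx.
  by rewrite (eq_sym i) (eq_sym j) (negbTE ki) (negbTE kj).
move=> [t st]; rewrite sat_meet // !sat_diag // => -[e1 e2].
by rewrite -(st i) 1?eq_sym // -(st j) 1?eq_sym // e1.
Qed.

Let d_sep i j (x : Fm) : i != j ->
  (Fm_cyl i (Fm_diag i j `&` x) `&` Fm_cyl i (Fm_diag i j `&` ~` x) = \bot)%O.
Proof.
move=> ij; apply: ext => M hM s; rewrite sat_meet // !sat_cyl // sat_bot //.
split=> // -[[t st]]; rewrite sat_meet // sat_diag // => -[td tx] [u su].
rewrite sat_meet // sat_diag // sat_compl // => -[ud]; apply.
suff -> : u = t by [].
apply/funext => a; have [->|ai] := eqVneq a i; last by rewrite st // su.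
by rewrite td ud st 1?eq_sym // su 1?eq_sym.
Qed.

HB.instance Definition _ := isCylindric.Build n Fm_display Fm
  c_bot c_ge c_meet cC d_refl d_cyl d_sep.

End TarskiLindenbaum.

Definition atomic_theory L n (T : theory L n) := atomic (Fm T).

Definition coatoms L n (T : theory L n) : set (formula L n) :=
  [set p | atom (Fm_class T (Not p))].

Definition nonprincipal L n (T : theory L n) (G : set (formula L n)) :=
  infimums [set Fm_class T p | p in G] \bot%O.

Section Representations.
Variables (n : nat) (d : Order.disp_t) (A : cylindricType n d) (M : Type).
Variable f : A -> set ('I_n -> M).

Definition unit_of : set ('I_n -> M) := f \top%O.
Local Notation V := unit_of.

(* [f] is an injective homomorphism into the full cylindric set algebra with
   unit [V]; the preservation clauses force every value to be a subset
   of [V]. *)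
Record representation : Prop := Representation {
  rep_base : \bigcup_(s in V) range s = setT;
  rep_inj : injective f;
  rep_bot : f \bot%O = set0;
  rep_meet : forall x y : A, f (x `&` y)%O = f x `&` f y;
  rep_join : forall x y : A, f (x `|` y)%O = f x `|` f y;
  rep_compl : forall x : A, f (~` x)%O = V `\` f x;
  rep_cyl : forall i (x : A),
    f (cyl i x) = [set s | V s /\ exists2 t, f x t & agree_off i s t];
  rep_diag : forall i j, f (diag i j) = [set s | V s /\ s i = s j] }.

(* A set with fewer than n points is vacuously a clique. *)
Definition clique (C : set M) :=
  forall s : 'I_n -> M, injective s -> range s `<=` C -> V s.

Definition Cm (m : nat) : set ('I_m -> M) := [set s | clique (range s)].

Definition square (m : nat) :=
  representation /\
  forall (s : 'I_m -> M) (a : A) (i : 'I_n) (l : 'I_n -> 'I_m),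
    Cm s -> injective l -> f (cyl i a) (s \o l) ->
    exists t, [/\ Cm t, agree_off (l i) s t & f a (t \o l)].

Definition LA : signature := @Signature A (fun=> n).

Fixpoint csat m (s : 'I_m -> M) (p : formula LA m) : Prop :=
  match p with
  | Eq i j => s i = s j
  | Rel a xs => f a (s \o xs)
  | Bot => False
  | Not q => ~ csat s q
  | And q r => csat s q /\ csat s r
  | Or q r => csat s q \/ csat s r
  | Ex i q => exists t, [/\ Cm t, agree_off i s t & csat t q]
  end.

Definition flat (m : nat) :=
  square m /\
  forall (p : formula LA m) (s : 'I_m -> M) (i j : 'I_m), Cm s -> i != j ->
    csat s (Ex i (Ex j p)) <-> csat s (Ex j (Ex i p)).

End Representations.

Definition square_model L n (T : theory L n) (m : nat) (M : Type)
  (f : Fm T -> set ('I_n -> M)) := square f m.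

Definition flat_model L n (T : theory L n) (m : nat) (M : Type)
  (f : Fm T -> set ('I_n -> M)) := flat f m.

Definition omits L n (T : theory L n) (M : Type) (f : Fm T -> set ('I_n -> M))
  (G : set (formula L n)) := \bigcap_(p in G) f (Fm_class T p) = set0.

(* Main.v *)
Require Import Defs.
From mathcomp Require Import all_boot all_order all_classical.
From mathcomp Require Import zify.
Set Implicit Arguments.
Unset Strict Implicit.
Unset Printing Implicit Defensive.
Import Order.TTheory.

(** Write n = k + 3.  The theory consists of the sentences true in one
    structure on the natural numbers, in which every injective tuple (x, y, b)
    with b of length k has a colour.  For fixed b this is a colouring of the
    oriented edges between the remaining points, and the colouring is
    constrained only on triangles, that is, on n points at a time.  A colour
    consists of one of three indices and either a shade (a level and a label)
    or nothing.  A colour with a shade is explicit and has a relation symbol.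
    The colour without shade is the limit of the explicit colours of its
    index, and no symbol names it.

    With n variables the limit colours are invisible.  The structure realizes
    every extension of at most n - 1 points by one point that respects
    triangles ([chi_extension]), because unprescribed edges at a new point can
    be given limit colours: two limit colours make a triangle harmless, and
    there are enough indices to keep a limit colour away from the two
    prescribed edges that it may meet.  An edge of a triangle can be changed
    above level N + 1 if the other two may change above level N
    ([triangle_extend]).  A back-and-forth argument then shows that a formula
    depends on the colours only up to some level ([sat_similar]), so every
    satisfiable formula holds of a tuple all of whose colours are explicit
    ([explicit_sat]), and the colours of such a tuple isolate its type
    ([diagram_atom]).  Hence the theory is atomic.

    A representation that omits the co-atoms realizes isolated types only, so
    all its colours are explicit ([V_realizes]).  This is contradictory on
    n + 3 points.  In a triangle of explicit colours with a common index, two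
    edges have the same level, the third has a lower level, and the labels of
    the first two are related by [turn].  A complete graph on four points with
    such triangles would be split by its top level into 1 + 3 or 2 + 2 points.
    The first is excluded because [turn] is an involution without fixed
    points, the second because [turn] and its conjugate by [flip] commute
    nowhere ([no_explicit_K4]).  To force such a graph, take k points b, two
    points x and y, and four points z over them, with zx of index 0 and level
    0 and yz of index 1 and level 0.  An edge between two of the z then has
    neither index 0 nor index 1 ([bottom_cone]), so all six have index 2
    ([no_four_cones]).  These are k + 2 + 4 = n + 3 points, and squareness
    provides the z one after the other ([builtS]). *)

(** * Colours and triangles *)

(** A label is a point of the Heisenberg group over the field with two
    elements.  [turn] translates by one generator, [flip] is an involution
    that exchanges the two generators; the commutator of [turn] with
    [flip \o turn \o flip] negates the last bit. *)
Definition label : Type := (bool * bool * bool)%type.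
Definition turn (l : label) : label := (~~ l.1.1, l.1.2, l.2).
Definition flip (l : label) : label := (l.1.2, l.1.1, l.2 (+) (l.1.1 && l.1.2)).

Lemma turnK : involutive turn. Proof. by case=> [[[] []] []]. Qed.
Lemma flipK : involutive flip. Proof. by case=> [[[] []] []]. Qed.
Lemma turn_free l : turn l <> l. Proof. by case: l => [[[] []] []]. Qed.
Lemma turn_flip_free l : turn (flip (turn (flip l))) <> flip (turn (flip (turn l))).
Proof. by case: l => [[[] []] []]. Qed.

Definition shade : Type := (nat * label)%type.
Definition colour : Type := ('I_3 * option shade)%type.

Definition conv_shade (r : shade) : shade := (r.1, flip r.2).
Definition conv (c : colour) : colour := (c.1, omap conv_shade c.2).

Lemma convK : involutive conv.
Proof. by case=> [i [[k l]|]] //=; rewrite /conv /conv_shade /= flipK. Qed.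

(** [r1] and [r2] are consecutive sides of an oriented triangle and meet in the
    vertex opposite [r3].  Seen from that vertex they have labels [flip r1.2]
    and [r2.2].  Since [turn] is a bijection, each of the two sides can be
    chosen freely if the other one adapts, whatever [r3] is below them: this
    is what lets high levels pass to the limit. *)
Definition peak (r1 r2 r3 : shade) :=
  [&& r1.1 == r2.1, r3.1 < r1.1 & r2.2 == turn (flip r1.2)].

(** [None] stands for a level above all others, at which labels are no longer
    visible. *)
Definition shade_ok (o1 o2 o3 : option shade) :=
  match o1, o2, o3 with
  | Some r1, Some r2, Some r3 => [|| peak r1 r2 r3, peak r2 r3 r1 | peak r3 r1 r2]
  | None, None, _ | None, _, None | _, None, None => true
  | _, _, _ => false
  end.

Definition triangle (c1 c2 c3 : colour) :=
  (c1.1 == c2.1) && (c2.1 == c3.1) ==> shade_ok c1.2 c2.2 c3.2.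

Lemma triangle_rot c1 c2 c3 : triangle c1 c2 c3 = triangle c2 c3 c1.
Proof.
rewrite /triangle; case: c1 c2 c3 => [i1 o1] [i2 o2] [i3 o3] /=.
have -> : (i1 == i2) && (i2 == i3) = (i2 == i3) && (i3 == i1).
  by apply/idP/idP => /andP[/eqP -> /eqP ->]; rewrite !eqxx.
case: o1 o2 o3 => [r1|] [r2|] [r3|] //=.
congr (_ ==> _).
by case: (peak r1 r2 r3); case: (peak r2 r3 r1); case: (peak r3 r1 r2).
Qed.

Lemma peak_conv r1 r2 r3 :
  peak (conv_shade r2) (conv_shade r1) (conv_shade r3) = peak r1 r2 r3.
Proof.
rewrite /peak /conv_shade /= eq_sym; case: eqVneq => //= ->; congr andb.
rewrite flipK [in RHS]eq_sym (can2_eq turnK turnK); congr (_ == _).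
Qed.

Lemma triangle_conv c1 c2 c3 :
  triangle (conv c3) (conv c2) (conv c1) = triangle c1 c2 c3.
Proof.
rewrite /triangle; case: c1 c2 c3 => [i1 o1] [i2 o2] [i3 o3] /=.
have -> : (i3 == i2) && (i2 == i1) = (i1 == i2) && (i2 == i3).
  by apply/idP/idP => /andP[/eqP -> /eqP ->]; rewrite !eqxx.
case: o1 o2 o3 => [r1|] [r2|] [r3|] //=.
congr (_ ==> _).
rewrite !peak_conv.
by case: (peak r1 r2 r3); case: (peak r2 r3 r1); case: (peak r3 r1 r2).
Qed.

(** Two limit colours make every triangle admissible; this is how free edges are
    filled in. *)
Lemma triangle_None c1 c2 c3 : c1.2 = None -> c2.2 = None -> triangle c1 c2 c3.
Proof. by rewrite /triangle => -> ->; case: c3.2 => [?|]; rewrite /= implybT. Qed.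

Definition explicit (c : colour) : bool := c.2.

Definition cut_shade N (o : option shade) : option shade :=
  if o is Some r then if r.1 < N then Some r else None else None.

(** What remains visible of a colour when levels from [N] on are confused with
    the limit. *)
Definition cut N (c : colour) : colour := (c.1, cut_shade N c.2).

Lemma cut_conv N c : cut N (conv c) = conv (cut N c).
Proof. by case: c => i [[l a]|] //=; rewrite /cut /conv /=; case: ltnP. Qed.

Lemma cut_shade_low N o : exists2 r, r.1 <= N & cut_shade N (Some r) = cut_shade N o.
Proof.
case: o => [r|]; last by exists (N, (false, false, false)); rewrite /= ?ltnn.
have [lt|ge] := ltnP r.1 N; first by exists r; rewrite // ltnW.
by exists (N, (false, false, false)); rewrite //= ltnn ltnNge ge.
Qed.

Lemma cut_explicit N c : exists2 c', explicit c' & cut N c' = cut N c.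
Proof.
by case: c => i o; have [r _ e] := cut_shade_low N o; exists (i, Some r); rewrite // /cut e.
Qed.

Lemma cutW N N' c c' : N <= N' -> cut N' c = cut N' c' -> cut N c = cut N c'.
Proof.
move=> le; suff cutE o : cut_shade N o = cut_shade N (cut_shade N' o).
  by case: c c' => [i o] [i' o'] [-> e]; rewrite /cut /= cutE e -cutE.
by case: o => [[l a]|] //=; case: (ltnP l N') => //= ge; rewrite ltnNge (leq_trans le).
Qed.

(** A side of high level, or a limit, forces another side to be high as well, and
    that side can absorb the change of the first one.  The loss from [N.+1] to
    [N] leaves the level [N] free for the third side, which has to be lower
    than the two top sides. *)
Lemma shade_extend N o p q o' :
  shade_ok o p q -> cut_shade N.+1 o' = cut_shade N.+1 o ->
  exists p' q', [/\ shade_ok o' p' q', cut_shade N p' = cut_shade N p,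
    cut_shade N q' = cut_shade N q & o' -> p' /\ q'].
Proof.
move=> ok.
case E: (cut_shade N.+1 o) => [r|] E'.
  have oE : o = Some r by move: E; case: (o) => //= r'; case: ifP.
  have -> : o' = o.
    by rewrite oE; move: E'; case: (o') => //= r'; case: ifP.
  move: ok; rewrite oE; case: p q => [p|] [q|] //= ok.
    by exists (Some p), (Some q).
  (* both other sides are limits: put both on one high level *)
  pose K := maxn N r.1.+1; pose l := (false, false, false) : label.
  exists (Some (K, l)), (Some (K, turn (flip l))); rewrite /= ltnNge leq_maxl /=.
  by split=> //; apply/or3P/Or32; rewrite /peak /= !eqxx leq_maxr.
(* the level of a side alone on top would not be attained twice *)
have high : cut_shade N p = None \/ cut_shade N q = None.
  case: o p q ok E {E'} => [[k a]|] [[k1 a1]|] [[k2 a2]|] //=; do ?by [left|right].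
  move=> ok; case: ltnP => // gtk _; move: ok; rewrite /peak /=.
  case: (ltnP k1 N) => h1; case: (ltnP k2 N) => h2; do ?by [left|right].
  by case/or3P => /and3P[/eqP e lt _]; lia.
case: o' E' => [[k a]|] /=; last first.
  move=> _; exists (cut_shade N p), (cut_shade N q).
  have cutK x : cut_shade N (cut_shade N x) = cut_shade N x.
    by case: x => //= x; case: ifP => //= ->.
  by split=> //; case: high => ->; case: cut_shade.
case: ltnP => // gtk _; case: high => [hp|hq].
  have [r rN rE] := cut_shade_low N q.
  exists (Some (k, turn (flip a))), (Some r); split=> //.
    by apply/or3P/Or31; rewrite /peak /= !eqxx /= andbT (leq_ltn_trans rN).
  by rewrite hp /= ltnNge ltnW.
have [r rN rE] := cut_shade_low N p.
exists (Some r), (Some (k, flip (turn a))); split=> //.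
  by apply/or3P/Or33; rewrite /peak /= flipK turnK !eqxx /= andbT (leq_ltn_trans rN).
by rewrite hq /= ltnNge ltnW.
Qed.

(** The amalgamation step behind elimination of high levels: replacing one edge
    of a triangle by an indistinguishable one.  Explicitness is tracked to
    produce tuples without limit colours. *)
Lemma triangle_extend N c d e c' :
  triangle c d e -> cut N.+1 c' = cut N.+1 c ->
  exists d' e', [/\ triangle c' d' e', cut N d' = cut N d, cut N e' = cut N e
    & explicit c' -> explicit d' /\ explicit e'].
Proof.
case: c d e c' => [i o] [j p] [m q] [i' o']; rewrite /triangle /= => tri [-> ee].
move: tri; case E: ((i == j) && (j == m)) => tri; last first.
  have [r _ re] := cut_shade_low N p; have [r' _ re'] := cut_shade_low N q.
  by exists (j, Some r), (m, Some r'); rewrite /cut re re' /= E.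
have [p' [q' [? cp cq ?]]] := shade_extend tri ee.
by exists (j, p'), (m, q'); rewrite /cut /= E cp cq.
Qed.

Lemma triangle_explicit N c d e : triangle c d e ->
  exists c' d' e', [/\ triangle c' d' e', explicit c', explicit d' & explicit e'] /\
    [/\ cut N c' = cut N c, cut N d' = cut N d & cut N e' = cut N e].
Proof.
move=> tri; have [c' ec' cc'] := cut_explicit N.+1 c.
have [d' [e' [tri' cd ce /(_ ec')[ed' ee']]]] := triangle_extend tri cc'.
exists c', d', e'; do 2 split => //.
exact: cutW cc'.
Qed.

(** The top level of the graph is attained on a complete bipartite subgraph,
    because no triangle has all its sides on one level.  If one point is split
    from three others, the labels at it are pairwise exchanged by [turn],
    impossible for three labels; if the split is 2 + 2, going around the
    4-cycle contradicts [turn_flip_free]. *)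
Lemma no_explicit_K4 (i : 'I_3) (r12 r13 r14 r23 r24 r34 : shade) :
  let e r : colour := (i, Some r) in
  triangle (e r12) (e r23) (conv (e r13)) ->
  triangle (e r12) (e r24) (conv (e r14)) ->
  triangle (e r13) (e r34) (conv (e r14)) ->
  triangle (e r23) (e r34) (conv (e r24)) -> False.
Proof.
rewrite /triangle /= !eqxx /= /peak /conv_shade /=.
case: r12 r13 r14 r23 r24 r34 => [k12 l12] [k13 l13] [k14 l14] [k23 l23] [k24 l24] [k34 l34] /=.
have fK : forall l, flip (flip l) = l := flipK.
have tK : forall l, turn (turn l) = l := turnK.
have t0 := turn_free; have tf0 := turn_flip_free.
(* choose the peak of each triangle; the levels leave 15 of the 81 choices, and
   the labels exclude these *)
case/or3P => /and3P[/eqP a1 b1 /eqP c1];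
case/or3P => /and3P[/eqP a2 b2 /eqP c2]; subst;
try (by clear -b1 b2; lia).
all: case/or3P => /and3P[/eqP a3 b3 /eqP c3]; subst;
try (by clear -b1 b2 b3; lia).
all: case/or3P => /and3P[/eqP a4 b4 /eqP c4]; subst;
try (by clear -b1 b2 b3 b4; lia).
all: congruence.
Qed.

(** * Adding one vertex *)

Definition upd (I : eqType) (D : Type) (t : I -> D) i v : I -> D :=
  fun j => if j == i then v else t j.

(** [chi [:: x, y & b]] is the colour of the edge from [x] to [y] over the
    parameters [b].  Different sequences [b] carry independent colourings. *)
Definition coherent k (P : eqType) (A : {pred P}) (chi : seq P -> colour) :=
  (forall x y b, size b = k -> uniq [:: x, y & b] -> all A [:: x, y & b] ->
     chi [:: y, x & b] = conv (chi [:: x, y & b])) /\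
  (forall x y z b, size b = k -> uniq [:: x, y, z & b] -> all A [:: x, y, z & b] ->
     triangle (chi [:: x, y & b]) (chi [:: y, z & b]) (chi [:: z, x & b])).

Definition word k (P : eqType) (A : {pred P}) (w : seq P) :=
  [/\ uniq w, size w = k.+2 & all A w].

(** The number [N] becomes a new point over the points [t j], [j \in J], playing
    the role of [i].  The colours of the edges at [N] within [i |: J] are
    prescribed by [E], the others have to be filled in. *)
Section OnePoint.
Variables (k N : nat) (chi : seq nat -> colour).
Hypothesis chi_coh : coherent k (fun x => x < N) chi.
Variables (t : 'I_k.+3 -> nat) (J : {set 'I_k.+3}) (i : 'I_k.+3).
Variable E : seq 'I_k.+3 -> colour.
Hypothesis iJ : i \notin J.
Hypothesis t_inj : {in J &, injective t}.
Hypothesis t_lt : forall j, j \in J -> t j < N.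
Hypothesis E_coh : coherent k (mem (i |: J)) E.
Hypothesis E_old : forall xs, word k (mem J) xs -> E xs = chi (map t xs).

Let t' := upd t i N.
Let D : {pred nat} := fun x => [exists j in i |: J, t' j == x].
Let idx x := odflt i [pick j in i |: J | t' j == x].

Let t'_inj : {in i |: J &, injective t'}.
Proof.
move=> a b; rewrite !inE /t' /upd.
have [->|ai] /= := eqVneq a i; have [->|bi] //= := eqVneq b i.
- by move=> _ bJ e; move: (t_lt bJ); rewrite e ltnn.
- by move=> aJ _ e; move: (t_lt aJ); rewrite e ltnn.
- exact: t_inj.
Qed.

Let idxP x : D x -> idx x \in i |: J /\ t' (idx x) = x.
Proof.
move=> /existsP[j /andP[jJ e]]; rewrite /idx; case: pickP => [l /andP[? /eqP]|/(_ j)] //.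
by rewrite jJ e.
Qed.

Let idxK j : j \in i |: J -> idx (t' j) = j.
Proof.
move=> jJ; have Dj : D (t' j) by apply/existsP; exists j; rewrite jJ eqxx.
by have [? e] := idxP Dj; apply: t'_inj.
Qed.

Let map_idx w : all D w -> [/\ map t' (map idx w) = w & all (mem (i |: J)) (map idx w)].
Proof.
move=> /allP Dw; split.
  by rewrite -map_comp -[RHS]map_id; apply/eq_in_map => x /Dw /idxP[].
by apply/allP => _ /mapP[x /Dw /idxP[? _] ->].
Qed.

(** The indices of the prescribed edges from the new point over [b].  Since [J]
    has at most k + 2 elements and [b] takes k of them, there are at most two,
    and a third index remains for the filler. *)
Let bad (b : seq nat) : {set 'I_3} :=
  [set (E [:: i, p & map idx b]).1 | p in J :\: [set x in map idx b]].
Definition filler b := odflt ord0 [pick j | j \notin bad b].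

Let fillerP b p : uniq b -> size b = k -> all D b -> N \notin b ->
  p \in J -> p \notin map idx b -> (E [:: i, p & map idx b]).1 != filler b.
Proof.
move=> ub sb Db Nb pJ pb.
have cb : #|bad b| <= 2.
  apply: leq_trans (leq_imset_card _ _) _.
  have [tb /allP bJ] := map_idx Db.
  have sub : [set x in map idx b] \subset J.
    apply/fintype.subsetP => x; rewrite inE => xb; move: (bJ _ xb); rewrite !inE => /orP[/eqP xi|//].
    case/negP: Nb; rewrite -tb; apply/mapP; exists x => //.
    by rewrite xi /t' /upd eqxx.
  rewrite cardsD (finset.setIidPr sub) cardsE.
  have -> : #|map idx b| = k.
    by rewrite (card_uniqP _) ?size_map //; apply: (@map_uniq _ _ t'); rewrite tb.
  have : #|i |: J| <= k.+3 by rewrite -[X in _ <= X]card_ord max_card.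
  by rewrite cardsU1 iJ; lia.
rewrite /filler; case: pickP => [j jb|all_bad] /=.
  by apply: contraNneq jb => <-; apply: imset_f; rewrite !inE pb.
have : #|'I_3| <= #|bad b|.
  by apply: subset_leq_card; apply/fintype.subsetP => j _; move: (all_bad j) => /negbFE.
by rewrite card_ord; lia.
Qed.

Definition extend (w : seq nat) : colour :=
  if N \notin w then chi w
  else if all D w then E (map idx w) else (filler (drop 2 w), None).

Let extend_in w : N \in w -> all D w -> extend w = E (map idx w).
Proof. by rewrite /extend => -> ->. Qed.

Let extend_fill w : N \in w -> ~~ all D w -> extend w = (filler (drop 2 w), None).
Proof. by rewrite /extend => -> /negbTE ->. Qed.

Let E_map w : uniq w -> size w = k.+2 -> all D w -> E (map idx w) = extend w.
Proof.
move=> uw sw Dw; case: (boolP (N \in w)) => Nw; first by rewrite extend_in.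
rewrite /extend Nw /=; have [tw wJ] := map_idx Dw.
have e : map t (map idx w) = w.
  rewrite -[RHS]tw; apply/eq_in_map => j jw; rewrite /t' /upd; case: eqP => // ji.
  by case/negP: Nw; rewrite -tw; apply/mapP; exists j; rewrite // /t' /upd ji eqxx.
rewrite E_old ?e //; split; rewrite ?size_map //.
  by apply: (@map_uniq _ _ t'); rewrite tw.
apply/allP => j jw; move: (allP wJ _ jw); rewrite !inE => /orP[/eqP ji|//].
by case/negP: Nw; rewrite -tw; apply/mapP; exists j; rewrite // /t' /upd ji eqxx.
Qed.

Let idx_uniq w : uniq w -> all D w -> uniq (map idx w).
Proof. by move=> uw Dw; apply: (@map_uniq _ _ t'); have [-> _] := map_idx Dw. Qed.

Let notin_lt w : all (fun x => x < N.+1) w -> N \notin w -> all (fun x => x < N) w.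
Proof.
move=> /allP h Nw; apply/allP => x xw; have := h _ xw; rewrite ltnS leq_eqVlt.
by case/orP=> // /eqP xN; rewrite -xN xw in Nw.
Qed.

Let D_N : D N.
Proof. by apply/existsP; exists i; rewrite !inE /t' /upd !eqxx. Qed.

(** A filled edge and a prescribed edge at the new point have different indices,
    so no constraint arises from the third side. *)
Let fill_edge b x : size b = k -> uniq [:: N, x & b] -> all D [:: N, x & b] ->
  (extend [:: N, x & b]).1 != filler b.
Proof.
move=> sb u Dx; rewrite extend_in ?mem_head //=.
have -> : idx N = i.
  have [iN tN] := idxP D_N; apply: t'_inj => //; first by rewrite !inE eqxx.
  by rewrite tN /t' /upd eqxx.
have [Nx ux] : N \notin x :: b /\ uniq (x :: b) by move: u => /= /andP[].
have Db : all D (x :: b) by move: Dx => /= /andP[].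
have ix := idx_uniq ux Db.
apply: fillerP => //.
- by case/andP: ux.
- by case/andP: Db.
- by apply: contra Nx; rewrite inE orbC => ->.
- have [/= [tx _] /andP[+ _]] := map_idx Db; rewrite !inE => /orP[/eqP xi|//].
  by move: Nx; rewrite -tx xi /t' /upd eqxx inE eqxx.
- by case/andP: ix.
Qed.

(** Consider a triangle that meets [N] and some point outside the prescribed part.
    If [N] is a parameter, at least two sides are filled.  If [N] is a vertex,
    then at most one of the two sides at [N] is prescribed, and the filled one
    avoids its index. *)
Lemma extend_coherent : coherent k (fun x => x < N.+1) extend.
Proof.
have cE := E_coh; have cchi := chi_coh.
have Hconv x y b : size b = k -> uniq [:: x, y & b] ->
    all (fun x => x < N.+1) [:: x, y & b] ->
    extend [:: y, x & b] = conv (extend [:: x, y & b]).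
  move=> sb u lt; case: (boolP (N \in [:: x, y & b])) => Nw; last first.
    rewrite /extend Nw; have -> : N \notin [:: y, x & b] by move: Nw; rewrite !inE orbCA.
    by apply: cchi.1 => //; apply: notin_lt.
  have Nw' : N \in [:: y, x & b] by move: Nw; rewrite !inE orbCA.
  case: (boolP (all D [:: x, y & b])) => Dw; last first.
    by rewrite !extend_fill //=; move: Dw; rewrite /= andbCA.
  have Dw' : all D [:: y, x & b] by move: Dw; rewrite /= andbCA.
  rewrite !extend_in //=; apply: cE.1; rewrite ?size_map //.
    exact: idx_uniq u Dw.
  by have [] := map_idx Dw.
split=> // x y z b sb u lt.
case: (boolP (N \in [:: x, y, z & b])) => Nw; last first.
  have h v : v \in [:: [:: x, y & b]; [:: y, z & b]; [:: z, x & b]] -> N \notin v.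
    move: Nw; rewrite !inE !negb_or => /and4P[Nx Ny Nz Nb].
    by case/or3P => /eqP ->; rewrite !inE !negb_or ?Nx ?Ny ?Nz.
  rewrite /extend !h ?inE ?eqxx ?orbT //; apply: cchi.2 => //; exact: notin_lt.
case: (boolP (all D [:: x, y, z & b])) => Dw.
  have sub v : v \in [:: [:: x, y & b]; [:: y, z & b]; [:: z, x & b]] ->
      [/\ uniq v, size v = k.+2 & all D v].
    move: u Dw; rewrite /= !inE !negb_or -!andbA.
    move=> /and5P[xy xz xb yz /and3P[yb zb ub]] /and4P[Dx Dy Dz Db].
    by case/or3P => /eqP ->; rewrite /= !inE ?negb_or ?sb ?Dx ?Dy ?Dz ?xy ?yz ?xb ?yb ?zb // eq_sym xz.
  have eE v : v \in [:: [:: x, y & b]; [:: y, z & b]; [:: z, x & b]] -> extend v = E (map idx v).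
    by move=> /sub[? ? ?]; rewrite E_map.
  rewrite !eE ?inE ?eqxx ?orbT //; apply: cE.2; rewrite ?size_map //; first exact: idx_uniq u Dw.
  by have [] := map_idx Dw.
have Hnew p q : uniq [:: p, q, N & b] -> ~~ all D [:: p, q, N & b] ->
    all (fun x => x < N.+1) [:: p, q, N & b] ->
    triangle (extend [:: p, q & b]) (extend [:: q, N & b]) (extend [:: N, p & b]).
  move=> {}u {}Dw {}lt.
  have [uNp uNq] : uniq [:: N, p & b] /\ uniq [:: N, q & b].
    move: u; rewrite /= !inE !negb_or -!andbA => /and5P[_ pN pb qN /and3P[qb -> ->]].
    by rewrite pb qb ![N == _]eq_sym pN qN.
  have ltq : all (fun x => x < N.+1) [:: N, q & b].
    by move: lt => /= /and4P[_ -> -> ->].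
  rewrite (Hconv N q) //.
    case: (boolP (all D [:: N, q & b])) => Dq; case: (boolP (all D [:: N, p & b])) => Dp.
    - case/negP: Dw; move: Dp Dq => /= /and3P[-> -> ->] /and3P[_ -> _].
      by [].
    - rewrite [extend [:: N, p & b]]extend_fill ?mem_head // /triangle /=.
      rewrite drop0 (_ : (extend [:: N, q & b]).1 == filler b = false) ?andbF //.
      exact/negbTE/fill_edge.
    - rewrite [extend [:: N, q & b]]extend_fill ?mem_head // /triangle /= drop0.
      rewrite [filler b == _]eq_sym.
      rewrite (_ : (extend [:: N, p & b]).1 == filler b = false) ?andbF //.
      exact/negbTE/fill_edge.
    - by rewrite triangle_rot triangle_None // extend_fill ?mem_head.
case: (boolP (N \in b)) => Nb; last first.
  move: Nw; rewrite !inE (negbTE Nb) orbF => /or3P[] /eqP e; subst.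
  - have pr : perm_eq [:: y, z, N & b] [:: N, y, z & b].
      exact/permPl/(perm_catCA [:: y; z] [:: N] b).
    by rewrite triangle_rot; apply: Hnew; rewrite ?(perm_uniq pr) ?(perm_all _ pr).
  - have pr : perm_eq [:: z, x, N & b] [:: x, N, z & b].
      exact/permPl/(perm_catCA [:: z] [:: x; N] b).
    by rewrite -triangle_rot; apply: Hnew; rewrite ?(perm_uniq pr) ?(perm_all _ pr).
  - exact: Hnew.
have fillE v : ~~ all D v -> N \in v -> (extend v).2 = None.
  by move=> Dv Nv; rewrite extend_fill.
have Nin p q : N \in [:: p, q & b] by rewrite !inE Nb !orbT.
move: Dw; rewrite /= !negb_and => /or4P[] Dv.
- by rewrite triangle_rot triangle_rot triangle_None //; apply: fillE; rewrite //= (negbTE Dv) ?andbF.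
- by rewrite triangle_None //; apply: fillE; rewrite //= (negbTE Dv) ?andbF.
- by rewrite triangle_rot triangle_None //; apply: fillE; rewrite //= (negbTE Dv) ?andbF.
- by rewrite triangle_None //; apply: fillE; rewrite //= (negbTE Dv) ?andbF.
Qed.

Lemma extend_spec xs : word k (mem (i |: J)) xs -> extend (map (upd t i N) xs) = E xs.
Proof.
move=> [u s /allP xsJ].
have Dx : all D (map t' xs).
  apply/allP => _ /mapP[j jx ->]; apply/existsP; exists j; rewrite eqxx andbT.
  exact: xsJ.
have idxs : map idx (map t' xs) = xs.
  by rewrite -map_comp -[RHS]map_id; apply/eq_in_map => j /xsJ /= /idxK.
rewrite -/t' -E_map ?idxs //; last by rewrite size_map.
by rewrite map_inj_in_uniq // => a b /xsJ aJ /xsJ bJ; apply: t'_inj.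
Qed.

Lemma extend_old w : N \notin w -> extend w = chi w.
Proof. by rewrite /extend => ->. Qed.
End OnePoint.

(** * A structure with all one-vertex extensions *)

Lemma coherent_ext k (P : eqType) (A : {pred P}) (c1 c2 : seq P -> colour) :
  (forall w, word k A w -> c1 w = c2 w) -> coherent k A c1 -> coherent k A c2.
Proof.
move=> e [h1 h2]; split=> [x y b sb u a|x y z b sb u a].
  rewrite -!e; first exact: h1.
    by split=> //=; rewrite sb.
  split; rewrite /= ?sb //; first by move: u; rewrite /= !inE !negb_or eq_sym; case: (y == x); case: (x \in b).
  by move: a => /= /and3P[-> -> ->].
have h v : v \in [:: [:: x, y & b]; [:: y, z & b]; [:: z, x & b]] -> word k A v.
  move: u a; rewrite /= !inE !negb_or -!andbA.
  move=> /and5P[xy xz xb yz /and3P[yb zb ub]] /and4P[Dx Dy Dz Db].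
  by case/or3P => /eqP ->; rewrite /word /= !inE ?negb_or ?sb ?Dx ?Dy ?Dz ?xy ?yz ?xb ?yb ?zb // eq_sym xz.
by rewrite -!e; [exact: h2|apply: h..]; rewrite !inE eqxx ?orbT.
Qed.

Section Limit.
Variable k : nat.

Definition valid N (chi : seq nat -> colour) (t : 'I_k.+3 -> nat)
    (J : {set 'I_k.+3}) (i : 'I_k.+3) (E : seq 'I_k.+3 -> colour) :=
  [/\ i \notin J, {in J &, injective t}, forall j, j \in J -> t j < N,
      coherent k (mem (i |: J)) E
    & forall xs, word k (mem J) xs -> E xs = chi (map t xs)].

(** A request for a new point: the data of an extension in countable form.  The
    leading number is padding, which makes each request recur at arbitrarily
    large points. *)
Definition request : Type := (nat * ({ffun 'I_k.+3 -> nat} * {set 'I_k.+3}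
  * 'I_k.+3 * {ffun k.+2.-tuple 'I_k.+3 -> colour}))%type.

Definition lookup (f : {ffun k.+2.-tuple 'I_k.+3 -> colour}) xs : colour :=
  if insub xs is Some u then f u else (ord0, None).

(** The point [N] answers the request with code [N].  A request that does not fit
    the colours obtained so far is replaced by an empty one. *)
Definition next_stage N (chi : seq nat -> colour) : seq nat -> colour :=
  let dflt := @extend k N chi (fun=> 0) finset.set0 ord0 (fun=> (ord0, None)) in
  if (unpickle N : option request) is Some (_, (t, J, i, f)) then
    if `[< valid N chi t J i (lookup f) >] then extend N chi t J i (lookup f) else dflt
  else dflt.

Fixpoint stage N : seq nat -> colour :=
  if N is N'.+1 then next_stage N' (stage N') else fun=> (ord0, None).

Lemma valid0 N chi : valid N chi (fun=> 0) finset.set0 ord0 (fun=> (ord0, None)).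
Proof.
split=> //; rewrite ?inE //; do ?by move=> ?; rewrite inE.
case=> [|x xs] [_ //= _ /andP[x0 _]].
by have : x \in finset.set0 := x0; rewrite inE.
Qed.

Lemma stage_coherent N : coherent k (fun x => x < N) (stage N).
Proof.
elim: N => [|N IH]; first by split=> [x y b|x y z b] _ _.
rewrite /= /next_stage; set dflt := extend _ _ _ _ _ _.
have d0 : coherent k (fun x => x < N.+1) dflt.
  by have [? ? ? ? ?] := valid0 N (stage N); apply: extend_coherent.
case: unpickle => [[_ [[[t J] i] f]]|] //; case: asboolP => // -[? ? ? ? ?].
exact: extend_coherent.
Qed.

Lemma stage_old N w : N \notin w -> stage N.+1 w = stage N w.
Proof.
move=> Nw; rewrite /= /next_stage; case: unpickle => [[_ [[[t J] i] f]]|]; last exact: extend_old.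
by case: asboolP => _; apply: extend_old.
Qed.

(** A word gets its final colour as soon as its largest point exists. *)
Definition chi w := stage (\max_(x <- w) x).+1 w.

Lemma chi_stage N w : all (fun x => x < N) w -> 0 < N -> chi w = stage N w.
Proof.
move=> /allP h; rewrite /chi; have: \max_(x <- w) x < N.-1.+1.
  rewrite ltnS; elim: w h => [|x w IH] h; first by rewrite big_nil.
  rewrite big_cons geq_max IH; first by rewrite andbT -ltnS (leq_trans (h _ (mem_head _ _))) // leqSpred.
  by move=> y yw; apply: h; rewrite inE yw orbT.
move=> lt N0; rewrite prednK // in lt; rewrite -(subnKC lt); elim: (N - _) => [|m IH].
  by rewrite addn0.
rewrite addnS [RHS]stage_old; first exact: IH.
apply/negP => mw.
have : \max_(x <- w) x >= (\max_(x <- w) x).+1 + m.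
  by apply: (@leq_bigmax_seq _ w xpredT id _ mw).
by rewrite addSn ltnNge leq_addr.
Qed.

Lemma chi_coherent : coherent k predT chi.
Proof.
split=> [x y b sb u _|x y z b sb u _].
  pose N := (\max_(v <- [:: x, y & b]) v).+1.
  have lt : all (fun v => v < N) [:: x, y & b].
    by apply/allP => v vw; rewrite ltnS; apply: (@leq_bigmax_seq _ _ xpredT id _ vw).
  rewrite !(@chi_stage N) //; first by apply: (stage_coherent N).1.
  by move: lt => /= /and3P[-> -> ->].
pose N := (\max_(v <- [:: x, y, z & b]) v).+1.
have lt : all (fun v => v < N) [:: x, y, z & b].
  by apply/allP => v vw; rewrite ltnS; apply: (@leq_bigmax_seq _ _ xpredT id _ vw).
have /= /and4P[lx ly lz lb] := lt.
rewrite !(@chi_stage N) //= ?lx ?ly ?lz //.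
exact: (stage_coherent N).2.
Qed.

Lemma unbounded (g : nat -> nat) (B : nat) : injective g -> exists m, B <= g m.
Proof.
move=> gi; apply: contrapT => no.
have lt m : g m < B by rewrite ltnNge; apply/negP => h; apply: no; exists m.
have := @uniq_leq_size _ (map g (iota 0 B.+1)) (iota 0 B).
rewrite map_inj_uniq ?iota_uniq // size_map !size_iota => h.
suff : B < B by rewrite ltnn.
by apply: (h isT) => _ /mapP[m _ ->]; rewrite mem_iota add0n lt.
Qed.

(** Every one-point extension of at most k + 2 points that is coherent is
    realized; this is the only property of the structure used below, besides
    its coherence. *)
Lemma chi_extension (t : 'I_k.+3 -> nat) (J : {set 'I_k.+3}) (i : 'I_k.+3)
    (E : seq 'I_k.+3 -> colour) :
  i \notin J -> {in J &, injective t} -> coherent k (mem (i |: J)) E ->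
  (forall xs, word k (mem J) xs -> E xs = chi (map t xs)) ->
  exists2 v, (forall j, j \in J -> t j <> v) &
    forall xs, word k (mem (i |: J)) xs -> chi (map (upd t i v) xs) = E xs.
Proof.
move=> iJ tI cE Eo.
pose f := [ffun u : k.+2.-tuple 'I_k.+3 => E u].
have fE (A : {pred 'I_k.+3}) xs : word k A xs -> lookup f xs = E xs.
  by move=> [_ /eqP s _]; rewrite /lookup insubT ffunE.
pose r m : request := (m, ([ffun j => t j], J, i, f)).
have [m le] : exists m, (\max_(j in J) t j).+1 <= pickle (r m).
  by apply: (@unbounded (pickle \o r)); apply: inj_comp (pcan_inj pickleK) _ => a b [].
set N := pickle (r m) in le.
have lt j : j \in J -> t j < N.
  by move=> jJ; apply: leq_trans le; rewrite ltnS; apply: leq_bigmax_cond.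
have N0 : 0 < N by apply: leq_trans le.
have tf : [ffun j => t j] = t :> ('I_k.+3 -> nat) by apply/funext => j; rewrite ffunE.
have vl : valid N (stage N) [ffun j => t j] J i (lookup f).
  rewrite tf; split=> //; first by apply: coherent_ext cE => xs /fE.
  move=> xs wx; rewrite (fE _ _ wx) Eo // (chi_stage _ N0) //.
  by case: wx => _ _ /allP h; apply/allP => _ /mapP[j /h jJ ->]; apply: lt.
exists N => [j /lt|xs wx]; first by move=> + e; rewrite e ltnn.
rewrite (@chi_stage N.+1) //; last first.
  case: wx => _ _ /allP h; apply/allP => _ /mapP[j /h jJ ->]; rewrite /upd.
  have : j \in i |: J := jJ.
  by rewrite !inE; case: eqP => //= _ /lt /ltnW.
rewrite /= /next_stage {1}/N pickleK -/N {1}/r asboolT //; rewrite tf in vl *.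
case: vl => ? ? ? ? ?.
by rewrite extend_spec // (fE _ _ wx).
Qed.
End Limit.

(** * Recolouring one triangle *)

Definition make_explicit N (c : colour) : colour :=
  (c.1, Some (odflt (N, (false, false, false)) c.2)).

Lemma make_explicit_conv N c : make_explicit N (conv c) = conv (make_explicit N c).
Proof. by case: c => i [[l a]|]. Qed.

Lemma cut_make_explicit N c : cut N (make_explicit N c) = cut N c.
Proof. by case: c => i [[l a]|] //=; rewrite /cut /= ltnn. Qed.

(** For fixed parameters, [U] is the set of the at most three remaining points.
    The colouring [S] is to be copied to one that agrees with [T] on the old
    edges, those not meeting the new point [i].  If [i] is a parameter ([ib]),
    no edge is old. *)
Section Link.
Variables (I : finType) (U : {set I}) (N : nat) (S T : I -> I -> colour).
Variables (i : I) (ib : bool) (Ex : Prop).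
Let old x y := [&& ~~ ib, x != i & y != i].
Hypothesis U3 : #|U| <= 3.
Hypothesis iU : ~~ ib -> i \in U.
Hypothesis Sconv : forall x y, x \in U -> y \in U -> x != y -> S y x = conv (S x y).
Hypothesis Stri : forall x y z, x \in U -> y \in U -> z \in U -> uniq [:: x; y; z] ->
  triangle (S x y) (S y z) (S z x).
Hypothesis Tconv : forall x y, x \in U -> y \in U -> x != y -> old x y -> T y x = conv (T x y).
Hypothesis Tcut : forall x y, x \in U -> y \in U -> x != y -> old x y ->
  cut N.+1 (T x y) = cut N.+1 (S x y).
Hypothesis Texp : Ex -> forall x y, x \in U -> y \in U -> x != y -> old x y -> explicit (T x y).

Definition tri_fun (p q r : I) (d1 d2 d3 : colour) x y : colour :=
  if (x == p) && (y == q) then d1 else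
  if (x == q) && (y == r) then d2 else
  if (x == r) && (y == p) then d3 else
  if (x == q) && (y == p) then conv d1 else
  if (x == r) && (y == q) then conv d2 else conv d3.

(** On three points the old edges are either none, and the whole triangle is chosen
    anew, or exactly one, and [triangle_extend] applies to it. *)
Lemma link_extend : exists F : I -> I -> colour,
  [/\ forall x y, x \in U -> y \in U -> x != y -> [/\ F y x = conv (F x y),
        cut N (F x y) = cut N (S x y), old x y -> F x y = T x y & Ex -> explicit (F x y)]
    & forall x y z, x \in U -> y \in U -> z \in U -> uniq [:: x; y; z] ->
        triangle (F x y) (F y z) (F z x)].
Proof.
have oldC x y : old y x = old x y by rewrite /old [X in _ && X]andbC.
have [U2|U2] := leqP #|U| 2.
  exists (fun x y => if old x y then T x y else make_explicit N (S x y)); split; last first.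
    move=> x y z xU yU zU u; have : size [:: x; y; z] <= size (enum U).
      by apply: uniq_leq_size => // a; rewrite !inE mem_enum => /or3P[] /eqP->.
    by rewrite -cardE /= leqNgt ltnS U2.
  move=> x y xU yU xy; rewrite oldC.
  case: ifP => // o; split=> //.
  - exact: Tconv.
  - by apply: cutW (Tcut _ _ _ _).
  - by move=> e; apply: Texp.
  - by rewrite -make_explicit_conv Sconv.
  - exact: cut_make_explicit.
(* the vertex r is opposite to the only edge that may be old *)
have [r rU ri] : exists2 r, r \in U & ~~ ib -> r = i.
  case: (ib) iU => [_|/(_ isT)]; last by exists i.
  have /card_gt0P[r rU] : 0 < #|U| by apply: leq_trans U2.
  by exists r.
have /cards2P[p [q [pq Upq]]] : #|U :\ r| == 2.
  by move: (cardsD1 r U); rewrite rU; lia.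
have [pU qU pr qr] : [/\ p \in U, q \in U, p != r & q != r].
  have : p \in U :\ r by rewrite Upq !inE eqxx.
  have : q \in U :\ r by rewrite Upq !inE eqxx orbT.
  by rewrite !inE => /andP[-> ->] /andP[-> ->].
have UE x : x \in U -> [|| x == p, x == q | x == r].
  move=> xU; have := erefl (x \in U :\ r); rewrite {2}Upq !inE xU andbT orbA.
  by case: (x == r) => //= <-.
have tS : triangle (S p q) (S q r) (S r p).
  by apply: Stri => //; rewrite /= !inE negb_or pq pr qr.
have [d1 [d2 [d3 [t3 c1 c2 c3 [o1 e123]]]]] : exists d1 d2 d3,
    [/\ triangle d1 d2 d3, cut N d1 = cut N (S p q), cut N d2 = cut N (S q r),
      cut N d3 = cut N (S r p) & (old p q -> d1 = T p q) /\
      (Ex -> [/\ explicit d1, explicit d2 & explicit d3])].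
  have [hib|hib] := boolP ib.
    have [d1 [d2 [d3 [[t3 ? ? ?] [? ? ?]]]]] := triangle_explicit N tS.
    by exists d1, d2, d3; split=> //; split=> //; rewrite /old hib.
  have o : old p q by rewrite /old hib -(ri hib) pr qr.
  have [d2 [d3 [t3 c2 c3 e]]] := triangle_extend tS (Tcut pU qU pq o).
  exists (T p q), d2, d3; split=> //; first exact: cutW (Tcut pU qU pq o).
  split=> // ex; have e1 := Texp ex pU qU pq o.
  by have [] := e e1.
have oldr x y : [|| x == r, y == r | x == y] -> old x y -> x == y.
  rewrite /old; case: (ib) ri => //= ->// h /andP[xi yi].
  by move: h; rewrite (negbTE xi) (negbTE yi).
exists (tri_fun p q r d1 d2 d3).
have nE := (negbTE pq, negbTE pr, negbTE qr, eq_sym q p, eq_sym r p, eq_sym r q, eqxx).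
have F1 : tri_fun p q r d1 d2 d3 p q = d1 by rewrite /tri_fun !nE.
have F2 : tri_fun p q r d1 d2 d3 q r = d2 by rewrite /tri_fun !nE.
have F3 : tri_fun p q r d1 d2 d3 r p = d3 by rewrite /tri_fun !nE ?andbF.
have F4 : tri_fun p q r d1 d2 d3 q p = conv d1 by rewrite /tri_fun !nE ?andbF.
have F5 : tri_fun p q r d1 d2 d3 r q = conv d2 by rewrite /tri_fun !nE ?andbF.
have F6 : tri_fun p q r d1 d2 d3 p r = conv d3 by rewrite /tri_fun !nE ?andbF.
have FE := (F1, F2, F3, F4, F5, F6).
have ce c : explicit (conv c) = explicit c by case: c => ? [[]|].
have C4 : cut N (conv d1) = cut N (S q p) by rewrite (Sconv pU qU pq) !cut_conv c1.
have C5 : cut N (conv d2) = cut N (S r q) by rewrite (Sconv qU rU qr) !cut_conv c2.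
have C6 : cut N (conv d3) = cut N (S p r).
  by rewrite (Sconv rU pU) 1?eq_sym // !cut_conv c3.
split.
  move=> x y /UE /or3P[] /eqP -> /UE /or3P[] /eqP ->; rewrite ?eqxx // => xy;
    rewrite !FE ?convK; split=> //; try by move=> /e123[]; rewrite ?ce.
  all: try by move=> /oldr; rewrite !eqxx ?orbT => /(_ isT); rewrite (negbTE xy).
  by rewrite oldC => o; rewrite o1 // (Tconv pU qU pq o).
move=> x y z /UE /or3P[] /eqP -> /UE /or3P[] /eqP -> /UE /or3P[] /eqP ->;
  rewrite /= !inE ?eqxx ?orbT /= ?andbF // !FE => _.
- by [].
- by rewrite triangle_conv.
- by rewrite triangle_rot triangle_conv.
- by rewrite -triangle_rot.
- by rewrite triangle_rot.
- by rewrite -triangle_rot triangle_conv.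
Qed.
End Link.

(** * Back and forth up to a level *)

Section BackAndForth.
Variable k : nat.
Notation I := 'I_k.+3.

Definition similar N (J : {set I}) (s t : I -> nat) :=
  {in J &, forall a b, (s a == s b) = (t a == t b)} /\
  forall xs, all (mem J) xs -> size xs = k.+2 -> uniq (map s xs) ->
    cut N (chi k (map t xs)) = cut N (chi k (map s xs)).

Definition explicit_on (J : {set I}) (t : I -> nat) :=
  forall xs, all (mem J) xs -> size xs = k.+2 -> uniq (map t xs) ->
    explicit (chi k (map t xs)).

Lemma similar_uniq N J s t xs : similar N J s t -> all (mem J) xs ->
  uniq (map s xs) = uniq (map t xs).
Proof.
move=> [e _]; elim: xs => //= x xs IH /andP[xJ xsJ]; rewrite IH //; congr (~~ _ && _).
apply/mapP/mapP => -[y ys /eqP exy]; exists y => //; apply/eqP.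
  by rewrite -e //; exact: (allP xsJ).
by rewrite e //; exact: (allP xsJ).
Qed.

Lemma similarW N N' J s t : N <= N' -> similar N' J s t -> similar N J s t.
Proof. by move=> le [h1 h2]; split=> // xs *; apply: (cutW le); apply: h2. Qed.

Let step_old N (s t : I -> nat) (J : {set I}) i j : j \in J -> s j = s i ->
  i \notin J -> similar N J s t ->
  similar N (i |: J) s (upd t i (t j)) /\
  (explicit_on J t -> explicit_on (i |: J) (upd t i (t j))).
Proof.
move=> jJ sj iJ [e c]; pose r a := if a == i then j else a.
have rJ a : a \in i |: J -> r a \in J by rewrite !inE /r; case: eqP.
have sr a : s a = s (r a) by rewrite /r; case: eqP => // ->.
have tr a : upd t i (t j) a = t (r a) by rewrite /upd /r; case: eqP.
have mr xs : all (mem (i |: J)) xs -> all (mem J) (map r xs).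
  by move=> /allP h; apply/allP => _ /mapP[a /h /= aJ ->]; apply: rJ.
have ms xs : map s xs = map s (map r xs) by rewrite -map_comp; apply: eq_map.
have mt xs : map (upd t i (t j)) xs = map t (map r xs) by rewrite -map_comp; apply: eq_map.
split; first split.
- by move=> a b aJ bJ; rewrite !tr !(sr a) !(sr b) e ?rJ.
- by move=> xs xJ sz; rewrite ms mt => u; rewrite c ?mr ?size_map.
by move=> ex xs xJ sz; rewrite mt => u; apply: ex; rewrite ?mr ?size_map.
Qed.

(** The back-and-forth step.  If the new coordinate repeats an old one, so does
    its copy.  Otherwise repeated coordinates are first discarded, and the
    colours of a new point are chosen separately for each sequence of
    parameters, since each edge with parameters lies in a single triangle of
    the at most n points involved. *)
Lemma similar_extend N (s t : I -> nat) (J : {set I}) i : i \notin J -> similar N.+1 J s t ->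
  exists v, similar N (i |: J) s (upd t i v) /\
    (explicit_on J t -> explicit_on (i |: J) (upd t i v)).
Proof.
move=> iJ st; have [[j jJ sj]|snew] := pselect (exists2 j, j \in J & s j = s i).
  by exists (t j); apply: step_old => //; apply: similarW st.
have sni j : j \in J -> s j != s i by move=> jJ; apply/eqP => e; apply: snew; exists j.
have [e c] := st.
(* J0 contains one coordinate for each value of t *)
pose J0 := [set j in J | [forall l in J, (t l == t j) ==> (j <= l)]].
have J0J j : j \in J0 -> j \in J by rewrite inE => /andP[].
have repP a : exists b, [/\ a \in J -> b \in J0, a \in J -> t b = t a & a \notin J -> b = a].
  have [aJ|aJ] := boolP (a \in J); last by exists a; split.
  have := @arg_minnP _ a (fun b => (b \in J) && (t b == t a)) (@nat_of_ord _).
  rewrite aJ eqxx => /(_ isT)[b /andP[bJ /eqP tb] min]; exists b; split=> // _.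
  rewrite inE bJ; apply/forallP => l; apply/implyP => lJ; apply/implyP => /eqP tl.
  by apply: min; rewrite lJ tl tb eqxx.
have [r rP] := boolp.choice repP.
have ri : r i = i by have [_ _ ->] := rP i.
have iJ0 : i \notin J0 by apply: contra iJ => /J0J.
have t0 : {in J0 &, injective t}.
  move=> a b /[dup] aJ0 /J0J aJ /[dup] bJ0 /J0J bJ tab.
  move: aJ0 bJ0; rewrite !inE => /andP[_ /forallP/(_ b)] + /andP[_ /forallP/(_ a)].
  rewrite aJ bJ tab eqxx /= => l1 l2; apply: val_inj; apply/eqP.
  by rewrite eqn_leq l1 l2.
have s0 : {in i |: J0 &, injective s}.
  move=> a b /finset.setU1P aJ /finset.setU1P bJ sab.
  case: aJ bJ sab => [->|aJ] [->|bJ] // sab.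
  - by move: (sni _ (J0J _ bJ)); rewrite sab eqxx.
  - by move: (sni _ (J0J _ aJ)); rewrite sab eqxx.
  - by apply: t0 => //; apply/eqP; rewrite -e ?J0J // sab.
pose K := i |: J0.
have Kuniq xs : all (mem K) xs -> uniq (map s xs) = uniq xs.
  move=> /allP h; apply: map_inj_in_uniq => a b /h aK /h bK; exact: s0.
have [chi1 chi2] := chi_coherent k.
have Kold a : a \in K -> a != i -> a \in J0 by move=> /finset.setU1P[->|//]; rewrite eqxx.
have link b : exists F : I -> I -> colour, size b = k -> uniq b -> all (mem K) b ->
  let ok x := (x \in K) && (x \notin b) in
  [/\ forall x y, ok x -> ok y -> x != y -> [/\ F y x = conv (F x y),
        cut N (F x y) = cut N (chi k (map s [:: x, y & b])),
        i \notin [:: x, y & b] -> F x y = chi k (map t [:: x, y & b])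
        & explicit_on J t -> explicit (F x y)]
    & forall x y z, ok x -> ok y -> ok z -> uniq [:: x; y; z] ->
        triangle (F x y) (F y z) (F z x)].
  have [[sb [ub bK]]|no] := pselect (size b = k /\ uniq b /\ all (mem K) b); last first.
    by exists (fun _ _ => (ord0, None)) => sb ub bK; case: no.
  pose U := [set x in K | x \notin b].
  have UE x : x \in U = (x \in K) && (x \notin b) by rewrite inE.
  have wordU x y : x \in U -> y \in U -> x != y ->
      all (mem K) [:: x, y & b] /\ uniq [:: x, y & b].
    rewrite !UE => /andP[xK xb] /andP[yK yb] xy.
    by split; [apply/and3P | rewrite /= ub inE negb_or xb yb xy].
  have oldw x y : x \in U -> y \in U -> [&& ~~ (i \in b), x != i & y != i] ->
      all (mem J0) [:: x, y & b].
    rewrite !UE => /andP[xK xb] /andP[yK yb] /and3P[ib xi yi].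
    apply/and3P; split; [exact: Kold..|]; apply/allP => a ab; apply: Kold; first exact: (allP bK).
    by apply: contraNneq ib => <-.
  have oldu x y : x \in U -> y \in U -> x != y -> [&& ~~ (i \in b), x != i & y != i] ->
      uniq (map t [:: x, y & b]).
    move=> xU yU xy o; have w := oldw _ _ xU yU o; have [_ u] := wordU _ _ xU yU xy.
    rewrite map_inj_in_uniq // => a a' /(allP w) aJ /(allP w) aJ'; exact: t0.
  have JW xs : all (mem J0) xs -> all (mem J) xs.
    by move=> /allP h; apply/allP => a /h; apply: J0J.
  have [|||||||F [F1 F2]] := @link_extend _ U N (fun x y => chi k (map s [:: x, y & b]))
     (fun x y => chi k (map t [:: x, y & b])) i (i \in b) (explicit_on J t).
  - have -> : U = K :\: [set x in b] by apply/finset.setP => a; rewrite !inE andbC.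
    have sub : [set x in b] \subset K.
      by apply/fintype.subsetP => a; rewrite inE => /(allP bK).
    have cb : #|[set x in b]| = k by rewrite cardsE; apply: etrans (card_uniqP ub) sb.
    rewrite cardsD (finset.setIidPr sub) cb.
    by rewrite leq_subLR addn3 -[X in _ <= X]card_ord max_card.
  - by move=> ib; rewrite UE ib finset.setU11.
  - move=> x y xU yU xy; have [aw uw] := wordU _ _ xU yU xy.
    by apply: chi1; rewrite ?size_map // -?map_cons ?Kuniq //; apply/allP.
  - move=> x y z; rewrite !UE => /andP[xK xb] /andP[yK yb] /andP[zK zb] u.
    apply: chi2; rewrite ?size_map //; last by apply/allP.
    rewrite -!map_cons Kuniq; last by apply/and4P.
    by move: u; rewrite /= !inE !negb_or xb yb zb ub !andbT.
  - move=> x y xU yU xy o; apply: chi1; rewrite ?size_map //; last by apply/allP.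
    exact: oldu.
  - move=> x y xU yU xy o; have [aw uw] := wordU _ _ xU yU xy.
    by apply: c; [apply/JW/oldw | rewrite /= sb | rewrite Kuniq].
  - by move=> ex x y xU yU xy o; apply: ex; [apply/JW/oldw|rewrite /= sb|apply: oldu].
  exists F => _ _ _ /=; split=> [x y xo yo xy|x y z xo yo zo u].
    have xU : x \in U by rewrite UE. have yU : y \in U by rewrite UE.
    have [f1 f2 f3 f4] := F1 x y xU yU xy; split=> // iw; apply: f3.
    by move: iw; rewrite !inE !negb_or ![i == _]eq_sym => /and3P[-> -> ->].
  by apply: F2; rewrite ?UE.
have [F FP] := boolp.choice link.
pose E (w : seq I) := if w is [:: x, y & b] then F b x y else (ord0, None).
have split_word x y b : word k (mem K) [:: x, y & b] ->
    [/\ [/\ size b = k, uniq b & all (mem K) b], (x \in K) && (x \notin b),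
       (y \in K) && (y \notin b) & x != y].
  case=> /= /and3P[+ yb ub] [sb] /and3P[xK yK bK].
  by rewrite inE negb_or => /andP[-> ->]; split=> //; apply/andP.
have EP w : word k (mem K) w -> [/\ cut N (E w) = cut N (chi k (map s w)),
    i \notin w -> E w = chi k (map t w) & explicit_on J t -> explicit (E w)].
  case: w => [|x [|y b]] ww; try by case: ww.
  have [[sb ub bK] xo yo xy] := split_word _ _ _ ww.
  by have [/(_ x y xo yo xy)[_ ? ? ?] _] := FP b sb ub bK.
have Ecoh : coherent k (mem K) E.
  split=> [x y b sb u a|x y z b sb u a].
    have [|[_ ub bK] xo yo xy] := split_word x y b; first by split=> //=; rewrite sb.
    by have [/(_ x y xo yo xy)[]] := FP b sb ub bK.
  have [|[_ ub bK] yo zo yz] := split_word y z b.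
    by split; [by case/andP: u|rewrite /= sb|by case/andP: a].
  have [_ F2] := FP b sb ub bK; apply: F2 => //.
    apply/andP; split; first by case/andP: a.
    by case/andP: u; rewrite !inE !negb_or => /and3P[].
  by move: u; rewrite /= !inE !negb_or -!andbA => /and5P[-> -> _ -> _].
have [|v vn vE] := chi_extension iJ0 t0 Ecoh.
  move=> xs [u sz /allP a]; have w : word k (mem K) xs.
    by split=> //; apply/allP => x /a xJ; apply/finset.setU1P; right.
  by have [_ + _] := EP xs w; apply; apply: contra iJ0 => /a.
exists v.
have tv j : j \in J -> (t j == v) = false.
  move=> jJ; have [rJ tr _] := rP j; rewrite -tr //; apply/eqP; exact: vn (rJ jJ).
have rK a : a \in i |: J -> r a \in K.
  move=> /finset.setU1P[->|aJ]; first by rewrite ri finset.setU11.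
  by apply/finset.setU1P; right; have [-> //] := rP a.
have tr a : a \in i |: J -> upd t i v (r a) = upd t i v a.
  move=> /finset.setU1P[->|aJ]; first by rewrite ri.
  have [rJ tra _] := rP a; rewrite /upd tra //.
  rewrite (negbTE (contraNneq _ iJ0)) ?(negbTE (contraNneq _ iJ)) //.
    by move=> <-.
  by move=> <-; apply: rJ.
have sr a : a \in i |: J -> s (r a) = s a.
  move=> /finset.setU1P[->|aJ]; first by rewrite ri.
  by have [rJ tra _] := rP a; apply/eqP; rewrite e ?tra //; apply/J0J/rJ.
have mapr xs : all (mem (i |: J)) xs ->
    [/\ all (mem K) (map r xs), map s (map r xs) = map s xs
      & map (upd t i v) (map r xs) = map (upd t i v) xs].
  move=> /allP h; split; first by apply/allP => _ /mapP[a /h aJ ->]; apply: rK.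
  - by rewrite -map_comp; apply/eq_in_map => a /h aJ; apply: sr.
  - by rewrite -map_comp; apply/eq_in_map => a /h aJ; apply: tr.
have pat : {in i |: J &, forall a b, (s a == s b) = (upd t i v a == upd t i v b)}.
  move=> a b /finset.setU1P aJ /finset.setU1P bJ.
  have jni j : j \in J -> (j == i) = false by move=> jJ; apply: contraNF iJ => /eqP <-.
  case: aJ bJ => [->|aJ] [->|bJ]; rewrite /upd ?eqxx ?jni //.
  - by rewrite eq_sym (negbTE (sni _ bJ)) eq_sym tv.
  - by rewrite (negbTE (sni _ aJ)) tv.
  - exact: e.
split.
  split=> // xs xJ sz u; have [rx srx trx] := mapr xs xJ.
  have w : word k (mem K) (map r xs).
    by split; rewrite ?size_map //; apply: (@map_uniq _ _ s); rewrite srx.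
  by rewrite -trx vE // -srx; have [] := EP _ w.
move=> ex xs xJ sz u; have [rx srx trx] := mapr xs xJ.
have w : word k (mem K) (map r xs).
  by split; rewrite ?size_map //; apply: (@map_uniq _ _ (upd t i v)); rewrite trx.
by rewrite -trx vE //; have [_ _] := EP _ w; apply.
Qed.
End BackAndForth.

(** * Formulas see finitely many levels *)

Definition lang k : signature := @Signature ('I_3 * shade)%type (fun=> k.+2).

Definition letters k (P : Type) (g : 'I_k.+2 -> P) : seq P := [seq g j | j <- enum 'I_k.+2].

Lemma letters_nth k (P : Type) x0 (w : seq P) : size w = k.+2 ->
  letters (fun j : 'I_k.+2 => nth x0 w j) = w.
Proof.
move=> sw; rewrite /letters (map_comp (nth x0 w) (@nat_of_ord _)) val_enum_ord -sw.
exact: mkseq_nth.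
Qed.

(** Only explicit colours have a relation symbol. *)
Definition model k : structure (lang k) :=
  @Structure (lang k) nat (inhabits 0)
    (fun c g => uniq (letters g) /\ chi k (letters g) = (c.1, Some c.2)).

Section QE.
Variable k : nat.
Notation n := k.+3.
Implicit Types (s t : 'I_n -> nat) (p q : formula (lang k) n).

Lemma similar_sym N J s t : similar N J s t -> similar N J t s.
Proof.
move=> st; have [e c] := st; split=> [a b aJ bJ|xs xJ sz u]; first by rewrite e.
by rewrite -c // (similar_uniq st).
Qed.

Lemma cut_explicit_eq N c d r : c.2 = Some r -> r.1 < N -> cut N c = cut N d -> c = d.
Proof.
case: c d => [i o] [j [r'|]] /= -> lt; rewrite /cut /= lt => -[->] //.
by case: ifP => // _ [->].
Qed.

Lemma model_step N s t i : similar N.+1 finset.setT s t -> forall s', agree_off i s s' ->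
  exists2 t', agree_off i t t' & similar N finset.setT s' t'.
Proof.
move=> [e c] s' ss'.
have [||v [h _]] := @similar_extend k N s' t [set~ i] i; first by rewrite !inE eqxx.
  have ms xs : all (mem [set~ i]) xs -> map s' xs = map s xs.
    by move=> /allP h; apply/eq_in_map => a /h ai; apply: ss'; move: (ai : a \in [set~ i]); rewrite !inE.
  split=> [a b|xs xi sz]; first by rewrite !inE => ai bi; rewrite !ss' ?e ?inE.
  rewrite (ms _ xi) => u; apply: c => //; apply/allP => a _; exact: finset.in_setT.
exists (upd t i v); first by move=> j ji; rewrite /upd (negbTE ji).
suff <- : i |: [set~ i] = finset.setT by [].
by apply/finset.setP => a; rewrite !inE orbN.
Qed.

(** Each quantifier costs one level, by [similar_extend]. *)
Theorem sat_similar p : exists N, forall s t, similar N finset.setT s t ->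
  sat (M := model k) s p <-> sat (M := model k) t p.
Proof.
elim: p => [i j|c xs||p [N H]|p [N H] q [N' H']|p [N H] q [N' H']|i p [N H]].
- exists 0 => s t [e _] /=; have := e i j; rewrite !finset.in_setT => /(_ isT isT) eij.
  by split=> /eqP; [rewrite eij|rewrite -eij] => /eqP.
- exists c.2.1.+1; suff imp s t : similar c.2.1.+1 finset.setT s t ->
      sat (M := model k) s (Rel c xs) -> sat (M := model k) t (Rel c xs).
    by move=> s t st; split; apply: imp => //; apply: similar_sym.
  move=> st; have [_ cc] := st; pose w := letters xs.
  have E u : letters (u \o xs) = map u w by rewrite /w /letters -map_comp.
  have wT : all (mem finset.setT) w by apply/allP => a _; exact: finset.in_setT.
  have sw : size w = k.+2 by rewrite size_map size_enum_ord.
  rewrite /= !E => -[u ch]; split; first by rewrite -(similar_uniq st).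
  by rewrite -ch; symmetry; apply: (@cut_explicit_eq c.2.1.+1 _ _ c.2); rewrite ?ch // -ch cc.
- by exists 0.
- by exists N => s t /H /= h; split=> a b; apply: a; apply/h.
- exists (maxn N N') => s t st /=.
  have := H _ _ (similarW (leq_maxl _ _) st); have := H' _ _ (similarW (leq_maxr _ _) st).
  by tauto.
- exists (maxn N N') => s t st /=.
  have := H _ _ (similarW (leq_maxl _ _) st); have := H' _ _ (similarW (leq_maxr _ _) st).
  by tauto.
- exists N.+1 => s t st /=; split=> -[s' ss' sp].
    by have [t' ? st'] := model_step st ss'; exists t' => //; apply/(H _ _ st').
  have [t' ? st'] := model_step (similar_sym st) ss'.
  by exists t' => //; apply/(H _ _ st').
Qed.

(** Coordinates are added one at a time, each losing one level. *)
Lemma explicit_dense N s : exists2 t, similar N finset.setT s t & explicit_on finset.setT t.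
Proof.
suff H (J : {set 'I_n}) M : exists2 t, similar M J s t & explicit_on J t by exact: H.
elim: {J}#|J| {-2}J (erefl #|J|) M => [|m IH] J cJ M.
  have J0 : J = finset.set0 by apply/eqP; rewrite -cards_eq0 cJ.
  have no xs : all (mem J) xs -> size xs = k.+2 -> False.
    by case: xs => //= x xs /andP[xJ _]; have : x \in J := xJ; rewrite J0 inE.
  by exists s; [split=> //|]; move=> xs a sz; case: (no xs a sz).
have /card_gt0P[i iJ] : 0 < #|J| by rewrite cJ.
have [|t st ex] := IH (J :\ i) _ M.+1; first by move: cJ; rewrite (cardsD1 i) iJ => -[].
have iJ' : i \notin J :\ i by rewrite !inE eqxx.
have [v [sv ev]] := similar_extend iJ' st.
rewrite finset.setD1K // in sv ev.
by exists (upd t i v) => //; apply: ev.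
Qed.
End QE.

(** * The theory of a structure *)

Section Syntax.
Variables (L : signature) (n : nat).
Implicit Types p q : formula L n.

Lemma sat_free_vars (M : structure L) p (s t : 'I_n -> M) :
  (forall i, i \in free_vars p -> s i = t i) -> sat s p <-> sat t p.
Proof.
elim: p s t => [i j|c xs||p H|p H q H'|p H q H'|i p H] s t e /=.
- by rewrite !e ?inE ?eqxx ?orbT.
- suff -> : s \o xs = t \o xs by [].
  by apply/funext => j /=; apply: e; apply/imsetP; exists j.
- by [].
- by have := H _ _ e; tauto.
- have hp : sat s p <-> sat t p by apply: H => i ip; apply: e; rewrite inE ip.
  have hq : sat s q <-> sat t q by apply: H' => i iq; apply: e; rewrite inE iq orbT.
  by tauto.
- have hp : sat s p <-> sat t p by apply: H => i ip; apply: e; rewrite inE ip.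
  have hq : sat s q <-> sat t q by apply: H' => i iq; apply: e; rewrite inE iq orbT.
  by tauto.
- have imp u v : (forall j, j \in free_vars p :\ i -> u j = v j) ->
      (exists2 u', agree_off i u u' & sat (M := M) u' p) -> exists2 v', agree_off i v v' & sat v' p.
    move=> uv [u' uu' up]; exists (fun j => if j == i then u' i else v j).
      by move=> j /negbTE ->.
    apply/(H u' _ _).1: up => j jp; case: eqP => [->//|/eqP ji].
    by rewrite uu' // uv // !inE ji.
  by split; apply: imp => // j /e.
Qed.

Definition univ p : formula L n := foldr (fun i q => Not (Ex i (Not q))) p (enum 'I_n).

Lemma univ_sentence p : sentence (univ p).
Proof.
rewrite /sentence /univ; apply/finset.setP => a; rewrite inE.
have : a \in enum 'I_n by rewrite mem_enum.
elim: (enum 'I_n) => //= b l IH; rewrite !inE; case: eqVneq => //= _ /IH.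
Qed.

(** Quantifying all n variables reaches every assignment, although a variable is
    bound in turn. *)
Lemma sat_univ (M : structure L) p (s : 'I_n -> M) : sat s (univ p) <-> forall t : 'I_n -> M, sat t p.
Proof.
rewrite /univ; suff H l (u : 'I_n -> M) : sat u (foldr (fun i q => Not (Ex i (Not q))) p l) <->
    forall t : 'I_n -> M, (forall j, j \notin l -> t j = u j) -> sat t p.
  by rewrite H; split=> h t //; apply: h => j; rewrite mem_enum.
elim: l u => [|i l IH] u /=.
  split=> [up t tu|]; last by apply.
  by suff -> : t = u by []; apply/funext => j; apply: tu.
split=> [h t tu|h [v uv]].
  apply: contrapT => nt; apply: h; exists (fun j => if j == i then t j else u j).
    by move=> j /negbTE ->.
  rewrite IH => /(_ t) h; apply: nt; apply: h => j jl; case: eqP => // /eqP ji.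
  by apply: tu; rewrite inE negb_or ji.
rewrite IH; apply => t tv; apply: h => j; rewrite inE negb_or => /andP[ji jl].
by rewrite tv // uv.
Qed.

Definition Th (M : structure L) : theory L n :=
  [set p | sentence p /\ forall s : 'I_n -> M, sat s p]%classic.

Lemma Th_model (M : structure L) : model_of (Th M) M.
Proof. by move=> p [_]. Qed.

(** The sentences true in [M] contain the universal closure of the implication, so
    equivalence modulo [Th M] is equivalence in [M]. *)
Lemma Th_imp (M : structure L) p q : (forall s : 'I_n -> M, sat s p -> sat s q) ->
  forall M', model_of (Th M) M' -> forall s : 'I_n -> M', sat s p -> sat s q.
Proof.
move=> pq M' hM' s sp.
have /hM'/(_ s)/sat_univ/(_ s) /= : Th M (univ (Or (Not p) q)).
  split; first exact: univ_sentence.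
  by move=> t; apply/sat_univ => u /=; have := pq u; have := EM (sat u p); tauto.
by tauto.
Qed.

Lemma Th_complete (M : structure L) : complete_theory (Th M).
Proof.
split; [by move=> p [] | by exists M; apply: Th_model |].
have ind p (s t : 'I_n -> M) : sentence p -> sat s p -> sat t p.
  by move=> sp; apply: (sat_free_vars _).1 => i; rewrite sp inE.
move=> p sp; have [[s ps]|no] := pselect (exists s : 'I_n -> M, sat s p).
  by left=> M' hM'; apply: hM'; split=> // t; apply: ind ps.
by right=> M' hM'; apply: hM'; split=> // t pt; apply: no; exists t.
Qed.

Section Order.
Variable M : structure L.
Local Notation T := (Th M).

Lemma class_le p q : (Fm_class T p <= Fm_class T q)%O <-> forall s : 'I_n -> M, sat s p -> sat s q.
Proof.
rewrite leEmeet; split=> [/eqP e s sp|pq].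
  have : sat s (And (repr (Fm_class T p)) (repr (Fm_class T q))).
    by apply/(sat_repr _ _ (@Th_model M)); rewrite [Fm_class T (And _ _)]e; apply/(sat_repr _ _ (@Th_model M)).
  by move=> /= [_]; rewrite sat_repr //; exact: Th_model.
apply/eqP/Fm_classP => M' hM' s /=; rewrite !sat_repr //.
by have := Th_imp pq hM' (s := s); tauto.
Qed.

Lemma class_eq p q : Fm_class T p = Fm_class T q <-> forall s : 'I_n -> M, sat s p <-> sat s q.
Proof.
split=> [/Fm_classP h s|h]; first by apply: h; apply: Th_model.
by apply/Fm_classP => M' hM' s; split; apply: (Th_imp _ hM') => t; rewrite h.
Qed.

Lemma class_bot p : Fm_class T p = \bot%O <-> forall s : 'I_n -> M, ~ sat s p.
Proof.
have -> : (\bot%O : Fm T) = Fm_class T Bot by [].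
by rewrite class_eq; split=> h s; have := h s => /=; tauto.
Qed.

Lemma class_not p : Fm_class T (Not p) = (~` Fm_class T p)%O.
Proof. by apply/Fm_classP => M' hM' s /=; rewrite sat_repr. Qed.

Lemma class_and p q : Fm_class T (And p q) = (Fm_class T p `&` Fm_class T q)%O.
Proof. by apply/Fm_classP => M' hM' s /=; rewrite !sat_repr. Qed.

Lemma class_cyl i p : Fm_class T (Ex i p) = cyl i (Fm_class T p).
Proof.
by apply/Fm_classP => M' hM' s /=; split=> -[t st /sat_repr tp]; exists t => //; apply: tp.
Qed.
End Order.

Definition bigand (I : eqType) (F : I -> formula L n) (l : seq I) : formula L n :=
  foldr (fun x q => And (F x) q) (Not Bot) l.

Lemma sat_bigand (M : structure L) (I : eqType) (F : I -> formula L n) l (s : 'I_n -> M) :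
  sat s (bigand F l) <-> forall x, x \in l -> sat s (F x).
Proof.
elim: l => [|x l IH] /=; first by split=> [_ x|_ []]; rewrite ?in_nil.
rewrite IH; split=> [[sx sl] y|h]; first by rewrite inE => /orP[/eqP->|/sl].
by split=> [|y yl]; apply: h; rewrite inE ?eqxx // yl orbT.
Qed.

(** A nonzero lower bound of the co-atoms would lie above an atom and below its
    complement. *)
Lemma coatoms_nonprincipal (T : theory L n) : atomic_theory T -> nonprincipal T (coatoms T).
Proof.
move=> at_T; split=> [_ [p _ <-]|x low]; first exact: le0x.
apply/negPn/negP => x0; have {}x0 : x <> \bot%O by move=> e; move: x0; rewrite e lexx.
have [a aat ax] := at_T x x0.
have ea : Fm_class T (Not (Not (repr a))) = a.
  rewrite -[RHS]Fm_classK; apply/Fm_classP => M hM s /=.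
  by split=> [|h nh //]; apply: contrapT.
have xa : (x <= Fm_class T (Not (repr a)))%O.
  by apply: low; exists (Not (repr a)) => //; rewrite /coatoms /= ea.
case: aat => a0 _; apply: a0; apply/eqP; rewrite -lex0.
have -> : (\bot%O : Fm T) = (a `&` Fm_class T (Not (repr a)))%O.
  rewrite -[X in (X `&` _)%O]Fm_classK; apply/Fm_classP => M hM s /=.
  by rewrite !sat_repr //=; tauto.
by rewrite lexI lexx (le_trans ax).
Qed.
End Syntax.

(** * Countability *)

Section Encoding.
Variables (k : nat).
Notation code_leaf := ('I_k.+3 * 'I_k.+3 + ('I_3 * shade) * {ffun 'I_k.+2 -> 'I_k.+3} + 'I_k.+3)%type.

Fixpoint encode (p : formula (lang k) k.+3) : GenTree.tree code_leaf :=
  match p with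
  | Eq i j => GenTree.Leaf (inl (inl (i, j)))
  | Rel c xs => GenTree.Leaf (inl (inr (c, xs)))
  | Bot => GenTree.Node 0 [::]
  | Not q => GenTree.Node 1 [:: encode q]
  | And q r => GenTree.Node 2 [:: encode q; encode r]
  | Or q r => GenTree.Node 3 [:: encode q; encode r]
  | Ex i q => GenTree.Node 4 [:: GenTree.Leaf (inr i); encode q]
  end.

Lemma encode_inj : injective encode.
Proof.
elim=> [i j|c xs||p H|p H q H'|p H q H'|i p H] [i' j'|c' xs'||p'|p' q'|p' q'|i' p'] //= [].
- by move=> -> ->.
- by move=> -> ->.
- by move=> /H ->.
- by move=> /H -> /H' ->.
- by move=> /H -> /H' ->.
- by move=> -> /H ->.
Qed.

Lemma lang_countable (T : theory (lang k) k.+3) : countable_theory T.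
Proof.
split; first exact: countableP.
apply/countable_injP; exists (pickle \o encode) => p q _ _.
by move=> /(pcan_inj pickleK) /encode_inj.
Qed.
End Encoding.

(** * Explicit tuples isolate atoms *)

Section Atoms.
Variable k : nat.
Notation n := k.+3.
Notation T := (@Th (lang k) n (model k)).
Implicit Types (s t : 'I_n -> model k) (p q : formula (lang k) n).

(** The equalities and the colours of [t]; for an explicit tuple this determines all
    colours exactly, hence satisfaction of all formulas. *)
Definition diagram (t : 'I_n -> model k) : formula (lang k) n :=
  And (bigand (fun ab : 'I_n * 'I_n => if t ab.1 == t ab.2 :> nat then Eq ab.1 ab.2
         else Not (Eq ab.1 ab.2)) (enum {: 'I_n * 'I_n}))
      (bigand (fun xs : {ffun 'I_k.+2 -> 'I_n} =>
         if uniq (letters (t \o xs) : seq nat) then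
           if (chi k (letters (t \o xs))).2 is Some r
           then @Rel (lang k) n ((chi k (letters (t \o xs))).1, r) xs else Not Bot
         else Not Bot) (enum {: {ffun 'I_k.+2 -> 'I_n}})).

Lemma sat_diagram t : sat t (diagram t).
Proof.
split; apply/sat_bigand => x _; first by case: eqP.
have top : sat t (Not Bot) by move=> /=.
case: ifP => // u; case E: (chi k _).2 => [r|] //; split=> //.
by rewrite -E -surjective_pairing.
Qed.

Lemma diagram_similar N s t : explicit_on finset.setT t -> sat s (diagram t) ->
  similar N finset.setT t s.
Proof.
move=> ex [/sat_bigand h1 /sat_bigand h2]; split=> [a b _ _|xs _ sz u].
  have := h1 (a, b); rewrite mem_enum => /(_ isT) /=; case: eqP => /= _ h; apply/esym/eqP => //.
pose f := [ffun j : 'I_k.+2 => nth ord0 xs j].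
have fE (g : 'I_n -> nat) : letters (g \o f) = map g xs.
  rewrite -[in RHS](letters_nth ord0 sz) /letters -map_comp.
  by apply: eq_map => j /=; rewrite ffunE.
have := h2 f; rewrite mem_enum => /(_ isT).
have xsT : all (mem finset.setT) xs by apply/allP => a _; exact: finset.in_setT.
have := ex xs xsT sz u; rewrite !fE u.
case E: (chi k (map t xs)) => [i [r|]] //= _.
by rewrite fE => -[_ ->].
Qed.

Lemma diagram_sat s t p : explicit_on finset.setT t -> sat s (diagram t) -> sat t p -> sat s p.
Proof.
by move=> ex d tp; have [N H] := sat_similar p; apply: (H t s _).1 tp; apply: diagram_similar.
Qed.

Lemma diagram_atom t : explicit_on finset.setT t -> atom (Fm_class T (diagram t)).
Proof.
move=> ex; split=> [/class_bot /(_ t)|b]; first by apply; apply: sat_diagram.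
rewrite -(Fm_classK b) => /class_le bd.
have [tb|tb] := pselect (sat t (repr b)).
  right; apply/class_eq => s; split; first exact: bd.
  by move=> sd; apply: (diagram_sat ex sd).
left; apply/class_bot => s sb; apply: tb.
have := diagram_sat (p := Not (repr b)) ex (bd s sb); apply: contraPP => /= ntb /(_ ntb).
by apply.
Qed.

Lemma explicit_sat s p : sat s p ->
  exists2 t : 'I_n -> model k, explicit_on finset.setT t & sat t p.
Proof.
move=> sp; have [N H] := sat_similar p; have [t st ex] := explicit_dense N s.
by exists t => //; apply: (H s t st).1 sp.
Qed.

Lemma Th_atomic : atomic_theory T.
Proof.
move=> x; rewrite -(Fm_classK x) => x0.
have [s sx] : exists s : 'I_n -> model k, sat s (repr x).
  by apply: contrapT => no; apply: x0; apply/class_bot => s sx; apply: no; exists s.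
have [t ex tx] := explicit_sat sx.
exists (Fm_class T (diagram t)); first exact: diagram_atom.
by apply/class_le => u ud; apply: diagram_sat ex ud tx.
Qed.
End Atoms.

(** * Four cones are contradictory *)

Definition i0 : 'I_3 := Ordinal (isT : 0 < 3).
Definition i1 : 'I_3 := Ordinal (isT : 1 < 3).
Definition i2 : 'I_3 := Ordinal (isT : 2 < 3).

(** Two sides of level 0 with a common index leave no room for a third side of
    that index: the third would have to lie below them, or one of them would
    have to share the top level with it and have the other strictly below. *)
Lemma bottom_cone (i : 'I_3) (l l' : label) c : explicit c ->
  triangle (i, Some (0, l)) c (i, Some (0, l')) -> c.1 != i.
Proof.
case: c => j [[m a]|] // _; rewrite /triangle /= eq_sym; apply: contraTneq => ->.
by rewrite eqxx; case: m => [|m].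
Qed.

(** The points 0 and 1 are the bases of the cones, the points 2, 3, 4, 5 their
    apexes. *)
Lemma no_four_cones (cc : nat -> nat -> colour) :
  (forall a b, a < 6 -> b < 6 -> a != b -> explicit (cc a b) /\ cc b a = conv (cc a b)) ->
  (forall a b c, a < 6 -> b < 6 -> c < 6 -> uniq [:: a; b; c] ->
     triangle (cc a b) (cc b c) (cc c a)) ->
  (forall a, 1 < a < 6 -> exists l, cc a 0 = (i0, Some (0, l)) /\ cc 1 a = (i1, Some (0, l))) ->
  False.
Proof.
move=> cE cT cG.
have red a b : 1 < a < 6 -> 1 < b < 6 -> a != b -> exists r, cc a b = (i2, Some r).
  move=> /[dup] ha /andP[a1 a6] /[dup] hb /andP[b1 b6] ab.
  have [ex _] := cE a b a6 b6 ab.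
  have [l [la la']] := cG a ha; have [l' [lb lb']] := cG b hb.
  have [_ ca] := cE a 0 a6 isT (lt0n_neq0 (ltnW a1)).
  have [_ cb] := cE 1 b isT b6 (negbT (ltn_eqF b1)).
  have n0 : (cc a b).1 != i0.
    apply: (@bottom_cone i0 (flip l) l' (cc a b)) => //.
    have := cT 0 a b isT a6 b6; rewrite ca la lb; apply.
    by rewrite /= !inE; lia.
  have n1 : (cc a b).1 != i1.
    apply: (@bottom_cone i1 l (flip l') (cc a b)) => //.
    have := cT 1 a b isT a6 b6; rewrite cb la' lb'; apply.
    by rewrite /= !inE; lia.
  case: (cc a b) ex n0 n1 => [i [r|]] //= _ n0 n1; exists r; congr pair.
  by apply: val_inj; case: i n0 n1 => [[|[|[|]]]].
have [r12 e12] := red 2 3 isT isT isT; have [r13 e13] := red 2 4 isT isT isT.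
have [r14 e14] := red 2 5 isT isT isT; have [r23 e23] := red 3 4 isT isT isT.
have [r24 e24] := red 3 5 isT isT isT; have [r34 e34] := red 4 5 isT isT isT.
have c42 := (cE 2 4 isT isT isT).2; have c52 := (cE 2 5 isT isT isT).2.
have c53 := (cE 3 5 isT isT isT).2.
have := cT 2 3 4 isT isT isT isT; have := cT 2 3 5 isT isT isT isT.
have := cT 2 4 5 isT isT isT isT; have := cT 3 4 5 isT isT isT isT.
rewrite c42 c52 c53 e12 e13 e14 e23 e24 e34 => t4 t3 t2 t1.
exact: (no_explicit_K4 t1 t2 t3 t4).
Qed.

(** * Types in a representation omitting the co-atoms *)

Section Representation.
Variable k : nat.
Notation n := k.+3.
Notation T := (@Th (lang k) n (model k)).
Variables (M : Type) (f : Fm T -> set ('I_n -> M)).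
Hypothesis rep : representation f.
Hypothesis om : omits f (coatoms T).
Implicit Types (s : 'I_n -> M) (t : 'I_n -> model k) (p q : formula (lang k) n).

Local Notation F p := (f (Fm_class T p)).
Local Notation V := (unit_of f).

Definition realizes s t := forall p, F p s <-> sat t p.

Lemma F_unit p s : F p s -> V s.
Proof.
move=> ps; rewrite /unit_of; have -> : (\top%O : Fm T) = (Fm_class T p `|` ~` Fm_class T p)%O.
  by rewrite Order.CTBDistrLatticeTheory.joinxC.
by rewrite (rep_join rep); left.
Qed.

Lemma F_not p s : F (Not p) s <-> V s /\ ~ F p s.
Proof. by rewrite class_not (rep_compl rep). Qed.

Lemma F_and p q s : F (And p q) s <-> F p s /\ F q s.
Proof. by rewrite class_and (rep_meet rep). Qed.

Lemma F_ex i p s : F (Ex i p) s <-> V s /\ exists2 s', F p s' & agree_off i s s'.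
Proof. by rewrite class_cyl (rep_cyl rep). Qed.

Lemma F_eq i j s : F (Eq i j) s <-> V s /\ s i = s j.
Proof. by have := rep_diag rep i j => /= ->. Qed.

(** A tuple of the unit escapes some co-atom, so it satisfies an atom; this atom is
    satisfied in the structure by an explicit tuple, whose type it isolates. *)
Lemma V_realizes s : V s -> exists2 t, explicit_on finset.setT t & realizes s t.
Proof.
move=> Vs; have [p /= [a0 amin] nps] : exists2 p, coatoms T p & ~ F p s.
  apply: contrapT => no; suff : set0 s by [].
  by rewrite -om => p cp; apply: contrapT => nps; apply: no; exists p.
have ps : F (Not p) s by apply/F_not.
have [u up] : exists u : 'I_n -> model k, sat u (Not p).
  by apply: contrapT => no; apply: a0; apply/class_bot => u up; apply: no; exists u.
have [t ex tp] := explicit_sat up; exists t => // q.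
have imp r : sat t r -> F r s.
  move=> tr; have le : (Fm_class T (And (Not p) r) <= Fm_class T (Not p))%O.
    by apply/class_le => v [].
  case: (amin _ le) => [/class_bot/(_ t) []//|e].
  by move: ps; rewrite -e => /F_and[].
split=> [qs|]; last exact: imp.
by apply: contrapT => nq; have /F_not[_] := imp (Not q) nq; apply.
Qed.

(** The unit is closed under copying one coordinate into another, since the theory
    contains the sentences saying that a value is equal to some value.  It need
    not be closed under permutations of the coordinates, so symmetries of the
    colours have to be obtained from such copies. *)
Lemma V_upd s t i j : V s -> realizes s t -> i != j ->
  V (upd s i (s j)) /\ realizes (upd s i (s j)) (upd t i (t j)).
Proof.
move=> Vs st ij.
have uE (D : Type) (v v' : 'I_n -> D) : agree_off i v v' -> v' i = v' j -> v' = upd v i (v j).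
  move=> vv e; apply/funext => a; rewrite /upd; case: eqP => [->|/eqP ai]; last exact: vv.
  by rewrite e vv // eq_sym.
have off (D : Type) (v : 'I_n -> D) x : agree_off i v (upd v i x).
  by move=> a /negbTE ai; rewrite /upd ai.
have ued (D : Type) (v : 'I_n -> D) : upd v i (v j) i = upd v i (v j) j.
  by rewrite /upd eqxx eq_sym (negbTE ij).
have H p : F (Ex i (And (Eq i j) p)) s <-> F p (upd s i (s j)).
  rewrite F_ex; split=> [[_ [s' /F_and[/F_eq[_ e] ps'] ss']]|ps].
    by rewrite -(uE _ _ _ ss' e).
  split=> //; exists (upd s i (s j)); last exact: off.
  apply/F_and; split=> //; apply/F_eq; split; last exact: ued.
  exact: F_unit ps.
have real : realizes (upd s i (s j)) (upd t i (t j)).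
  move=> p; rewrite -H st /=; split=> [[t' tt' [e tp]]|tp]; first by rewrite -(uE _ _ _ tt' e).
  by exists (upd t i (t j)); [exact: off|split=> //; exact: ued].
by split=> //; apply: (@F_unit (Not Bot)); apply/real => /=.
Qed.

Definition o0 : 'I_n := Ordinal (isT : 0 < n).
Definition o1 : 'I_n := Ordinal (isT : 1 < n).
Definition o2 : 'I_n := Ordinal (isT : 2 < n).
(** The coordinates that serve as parameters; the coordinates [o0], [o1], [o2] are
    the vertices of a triangle. *)
Definition params : seq 'I_n := drop 3 (enum 'I_n).

Lemma size_params : size params = k.
Proof. by rewrite size_drop size_enum_ord; lia. Qed.

Lemma mem_params a : (a \in params) = (2 < a).
Proof.
rewrite /params -(mem_map val_inj) map_drop val_enum_ord /= -[3]/(3 + 0) drop_iota mem_iota.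
by have := ltn_ord a; lia.
Qed.

Lemma uniq_params : uniq params.
Proof. by rewrite drop_uniq // enum_uniq. Qed.

Lemma enum_n : enum 'I_n = [:: o0, o1, o2 & params].
Proof.
by apply: (inj_map val_inj); rewrite val_enum_ord /= /params map_drop val_enum_ord /= drop0.
Qed.

Definition edge_word x y : {ffun 'I_k.+2 -> 'I_n} := [ffun j => nth ord0 [:: x, y & params] (nat_of_ord j)].

Definition edge (c : 'I_3 * shade) x y : formula (lang k) n := @Rel (lang k) n c (edge_word x y).

Lemma letters_edge (D : Type) (g : 'I_n -> D) x y :
  letters (g \o edge_word x y) = map g [:: x, y & params].
Proof.
rewrite -[in RHS](@letters_nth k _ ord0 [:: x, y & params]) /= ?size_params //.
by rewrite /letters -map_comp; apply: eq_map => j /=; rewrite ffunE.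
Qed.

Lemma sat_edge t c x y : sat t (edge c x y) <->
  uniq (map (t : 'I_n -> nat) [:: x, y & params]) /\ chi k (map t [:: x, y & params]) = (c.1, Some c.2).
Proof. by rewrite /edge [sat _ _]/= letters_edge. Qed.

(** Quantifying a coordinate that the edge does not mention leaves the formula
    unchanged modulo the theory, which transfers it between tuples of the unit. *)
Lemma edge_agree s s' c x y z : V s -> V s' -> agree_off z s s' -> z \notin [:: x, y & params] ->
  F (edge c x y) s -> F (edge c x y) s'.
Proof.
move=> Vs Vs' ss' zw es.
have [t' _ st'] := V_realizes Vs'; apply/st'.
have : F (Ex z (edge c x y)) s'.
  by apply/F_ex; split=> //; exists s => // a az; rewrite ss'.
move/st' => [t'' tt' /sat_edge h]; apply/sat_edge.
suff <- : map t'' [:: x, y & params] = map t' [:: x, y & params] by [].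
by apply/eq_in_map => a aw; apply: tt'; apply: contraNneq zw => <-.
Qed.

(** The point [o2] is an apex over [o0] and [o1].  Different labels [l] make apexes
    different. *)
Definition cone (l : label) : formula (lang k) n :=
  And (edge (i0, (0, l)) o2 o0) (edge (i1, (0, l)) o1 o2).

Lemma low_cases a : a \notin params -> [|| a == o0, a == o1 | a == o2].
Proof. by rewrite mem_params; case: a => [[|[|[|]]]]. Qed.

(** The two prescribed edges have different indices, so they are compatible with any
    colour of the edge between the bases; all other new edges get a limit
    colour. *)
Lemma cone_extension t l : uniq (map (t : 'I_n -> nat) [:: o0, o1 & params]) -> sat t (Ex o2 (cone l)).
Proof.
move=> u; pose J := [set~ o2].
have [chi1 chi2] := chi_coherent k.
have tJ : {in J &, injective (t : 'I_n -> nat)}.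
  have w a : a \in J -> a \in [:: o0, o1 & params].
    rewrite !inE => a2; have := mem_enum 'I_n a; rewrite enum_n !inE.
    by rewrite (negbTE a2).
  move=> a b /w aw /w bw tab.
  have ia := index_mem a [:: o0, o1 & params]; have ib := index_mem b [:: o0, o1 & params].
  rewrite aw in ia; rewrite bw in ib.
  apply/eqP; rewrite -(nth_index o0 aw) -(nth_index o0 bw) nth_uniq //; last exact: map_uniq u.
  rewrite -(nth_uniq (t o0) _ _ u) ?size_map // !(nth_map o0) //.
  by rewrite !nth_index // tab.
pose c0 : colour := (i0, Some (0, l)); pose c1 : colour := (i1, Some (0, l)).
pose G x y := if x == o2 then if y == o0 then c0 else conv c1
  else if y == o2 then if x == o0 then conv c0 else c1 else chi k (map t [:: x, y & params]).
pose E (w : seq 'I_n) := if o2 \notin w then chi k (map t w) else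
  if drop 2 w == params then G (nth o0 w 0) (nth o0 w 1) else (ord0, None).
have Jt w : o2 \notin w -> uniq w -> uniq (map (t : 'I_n -> nat) w).
  move=> ow uw; rewrite map_inj_in_uniq // => a b aw bw; apply: tJ; rewrite !inE.
    by apply: contraNneq ow => <-.
  by apply: contraNneq ow => <-.
have allT (w : seq nat) : all predT w by apply/allP.
have Gconv x y : x \notin params -> y \notin params -> x != y -> o2 \in [:: x; y] -> G y x = conv (G x y).
  move=> /low_cases/or3P[] /eqP -> /low_cases/or3P[] /eqP -> //= _ _;
  by rewrite /G /= ?convK.
have Ecoh : coherent k (mem (o2 |: J)) E.
  split=> [x y b sb uw _|x y z b sb uw _].
    rewrite /E /= !inE; have -> : [|| o2 == y, o2 == x | o2 \in b] = [|| o2 == x, o2 == y | o2 \in b].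
      by rewrite orbCA.
    case: ifP => [ow|/negbFE ow].
      by apply: chi1; rewrite ?size_map // -!map_cons Jt // !inE.
    rewrite drop0; case: eqP => // bt; rewrite bt in uw ow.
    move: uw; rewrite /= inE negb_or => /and3P[/andP[xy xt] yt _].
    apply: Gconv => //; move: ow; rewrite !inE mem_params /= orbF.
    by [].
  case: (boolP (o2 \in [:: x, y, z & b])) => ow; last first.
    move: (ow); rewrite !inE !negb_or => /and4P[ox oy oz ob].
    rewrite /E !inE !negb_or ox oy oz ob /=.
    by apply: chi2; rewrite ?size_map // -!map_cons Jt.
  case: (eqVneq b params) => [bt|bt].
    have ot : o2 \notin params by rewrite mem_params.
    move: uw; rewrite bt /= !inE !negb_or -!andbA => /and5P[xy xz xt yz /and3P[yt zt _]].
    rewrite /E /= !drop0 !eqxx.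
    move: xt yt zt xy xz yz => /low_cases/or3P[] /eqP -> /low_cases/or3P[] /eqP -> /low_cases/or3P[] /eqP ->;
       rewrite ?eqxx // => _ _ _; rewrite !inE (negbTE ot) /G /triangle /= ?andbF //.
    - by case: eqP => //= <-.
    - by case: eqP => //= <-.
  have none v w : o2 \in [:: v, w & b] -> E [:: v, w & b] = (ord0, None).
    by move=> oi; rewrite /E oi /= drop0 (negbTE bt).
  have [ob|ob] := boolP (o2 \in b).
    by apply: triangle_None; rewrite none // !inE ob !orbT.
  move: ow; rewrite !inE (negbTE ob) orbF => /or3P[] /eqP o2E.
  - by rewrite triangle_rot triangle_rot triangle_None // none // !inE -o2E eqxx ?orbT.
  - by rewrite triangle_None // none // !inE -o2E eqxx ?orbT.
  - by rewrite triangle_rot triangle_None // none // !inE -o2E eqxx ?orbT.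
have oJ : o2 \notin J by rewrite !inE eqxx.
have [|v vn vE] := chi_extension oJ tJ Ecoh.
  move=> xs [_ _ /allP xJ]; rewrite /E ifT //; apply/negP => /xJ oJ'.
  by case/negP: oJ.
have oT : o2 |: J = finset.setT by apply/finset.setP => a; rewrite !inE orbN.
have t'_inj : injective (upd (t : 'I_n -> nat) o2 v).
  move=> a b; rewrite /upd; case: eqP => [->|/eqP ao]; case: eqP => [->|/eqP bo] //.
  - by move=> e; case: (vn b); rewrite ?inE.
  - by move=> e; case: (vn a); rewrite ?inE.
  - by apply: tJ; rewrite !inE.
have ot : o2 \notin params by rewrite mem_params.
have wE x y : x \notin params -> y \notin params -> x != y ->
    uniq (map (upd (t : 'I_n -> nat) o2 v) [:: x, y & params]) /\
    chi k (map (upd (t : 'I_n -> nat) o2 v) [:: x, y & params]) = E [:: x, y & params].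
  move=> xt yt xy; have uw : uniq [:: x, y & params] by rewrite /= inE negb_or xy xt yt uniq_params.
  split; first by rewrite map_inj_uniq.
  apply: vE; split=> //; first by rewrite /= size_params.
  by rewrite oT; apply/allP => a _; exact: finset.in_setT.
have [ot0 ot1] : o0 \notin params /\ o1 \notin params by rewrite !mem_params.
exists (upd t o2 v); first by move=> a /negbTE ao; rewrite /upd ao.
split; apply/sat_edge.
  have [u1 e] := wE o2 o0 ot ot0 isT; split; first exact: u1.
  by rewrite e /E inE eqxx /= drop0 eqxx.
have [u1 e] := wE o1 o2 ot1 ot isT; split; first exact: u1.
by rewrite e /E !inE eqxx orbT /= drop0 eqxx.
Qed.

(** In a word of n - 1 coordinates one coordinate is free.  Copying an endpoint of
    the edge there moves that endpoint. *)
Lemma edge_move_l s c x y z : V s -> z != x -> z \notin y :: params ->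
  F (edge c x y) s -> F (edge c z y) (upd s z (s x)).
Proof.
move=> Vs zx zy; have [t _ st] := V_realizes Vs; have [_ st'] := V_upd Vs st zx.
move=> /st /sat_edge h; apply/st'/sat_edge.
suff -> : map (upd t z (t x)) [:: z, y & params] = map t [:: x, y & params] by [].
rewrite [LHS]/= {1}/upd eqxx; congr cons; rewrite -map_cons.
by apply/eq_in_map => a aw; rewrite /upd; case: eqP zy => // <-; rewrite aw.
Qed.

Lemma edge_move_r s c x y z : V s -> z != y -> z \notin x :: params ->
  F (edge c x y) s -> F (edge c x z) (upd s z (s y)).
Proof.
move=> Vs zy zx; have [t _ st] := V_realizes Vs; have [_ st'] := V_upd Vs st zy.
move=> /st /sat_edge h; apply/st'/sat_edge.
suff -> : map (upd t z (t y)) [:: x, z & params] = map t [:: x, y & params] by [].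
have off a : a \in x :: params -> upd t z (t y) a = t a.
  by move=> aw; rewrite /upd; case: eqP zx => // <-; rewrite aw.
rewrite /= off ?mem_head // {1}/upd eqxx; congr [:: _, _ & _].
by apply/eq_in_map => a aw; apply: off; rewrite inE aw orbT.
Qed.

(** * The colours of a clique *)

Section Configuration.
Notation m := k.+3.+3.
Implicit Types (S : 'I_m -> M) (u v w : 'I_m).

(** Inserts three points of an m-tuple before the k parameters, which occupy its
    positions from 6 on. *)
Definition frame u v w (a : 'I_n) : 'I_m :=
  if a == o0 then u else if a == o1 then v else if a == o2 then w else inord (a + 3).

Lemma frame_upd0 S u v w x : upd (S \o frame u v w) o0 (S x) = S \o frame x v w.
Proof. by apply/funext => a; rewrite /upd /= /frame; case: eqP. Qed.

Lemma frame_upd1 S u v w x : upd (S \o frame u v w) o1 (S x) = S \o frame u x w.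
Proof. by apply/funext => a; rewrite /upd /= /frame; case: eqP => // ->. Qed.

Lemma frame_upd2 S u v w x : upd (S \o frame u v w) o2 (S x) = S \o frame u v x.
Proof. by apply/funext => a; rewrite /upd /= /frame; case: eqP => // ->. Qed.

Lemma frame_off2 S u v w w' : agree_off o2 (S \o frame u v w) (S \o frame u v w').
Proof. by move=> a /negbTE a2; rewrite /= /frame a2. Qed.

Lemma o2_edge : o2 \notin [:: o0, o1 & params]. Proof. by rewrite !inE mem_params. Qed.

Lemma copy_edge_r S c u v w x y z : z != y -> z \notin x :: params ->
  F (edge c x y) (S \o frame u v w) ->
  F (edge c x z) (upd (S \o frame u v w) z (S (frame u v w y))).
Proof. by move=> zy zx e; have := edge_move_r (F_unit e) zy zx e. Qed.

Lemma copy_edge_l S c u v w x y z : z != x -> z \notin y :: params ->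
  F (edge c x y) (S \o frame u v w) ->
  F (edge c z y) (upd (S \o frame u v w) z (S (frame u v w x))).
Proof. by move=> zy zx e; have := edge_move_l (F_unit e) zy zx e. Qed.

(** Rotations and reversals of a triangle are obtained by copying endpoints into the
    free coordinate, as in the solution of a sliding puzzle; the intermediate
    tuples have repetitions and therefore lie in the unit. *)
Lemma edge_rot1 S c u v w : V (S \o frame v w u) ->
  F (edge c o1 o2) (S \o frame u v w) -> F (edge c o0 o1) (S \o frame v w u).
Proof.
move=> V2 e; have t0 : o0 \notin o2 :: params by rewrite inE mem_params.
have t1 : o1 \notin o0 :: params by rewrite inE mem_params.
have := copy_edge_l (isT : o0 != o1) t0 e; rewrite frame_upd0 => e1.
have := copy_edge_r (isT : o1 != o2) t1 e1; rewrite frame_upd1 => e2.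
exact: edge_agree (F_unit e2) V2 (frame_off2 _ _ _ _ _) o2_edge e2.
Qed.

Lemma edge_rot2 S c u v w : V (S \o frame w u v) ->
  F (edge c o2 o0) (S \o frame u v w) -> F (edge c o0 o1) (S \o frame w u v).
Proof.
move=> V2 e; have t0 : o1 \notin o2 :: params by rewrite inE mem_params.
have t1 : o0 \notin o1 :: params by rewrite inE mem_params.
have := copy_edge_r (isT : o1 != o0) t0 e; rewrite frame_upd1 => e1.
have := copy_edge_l (isT : o0 != o2) t1 e1; rewrite frame_upd0 => e2.
exact: edge_agree (F_unit e2) V2 (frame_off2 _ _ _ _ _) o2_edge e2.
Qed.

Lemma edge_swap S c u v w : V (S \o frame v u w) ->
  F (edge c o1 o0) (S \o frame u v w) -> F (edge c o0 o1) (S \o frame v u w).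
Proof.
move=> V2 e; have t0 : o2 \notin o1 :: params by rewrite inE mem_params.
have t1 : o0 \notin o2 :: params by rewrite inE mem_params.
have t2 : o1 \notin o0 :: params by rewrite inE mem_params.
have := copy_edge_r (isT : o2 != o0) t0 e; rewrite frame_upd2 => e1.
have := copy_edge_l (isT : o0 != o1) t1 e1; rewrite frame_upd0 => e2.
have := copy_edge_r (isT : o1 != o2) t2 e2; rewrite frame_upd1 => e3.
exact: edge_agree (F_unit e3) V2 (frame_off2 _ _ _ _ _) o2_edge e3.
Qed.

Definition pt (a : nat) : 'I_m := inord a.

Lemma val_pt a : a < 6 -> pt a = a :> nat.
Proof. by move=> h; rewrite /pt inordK // (leq_trans h). Qed.

Lemma third_point a b : a != b -> exists2 d, d < 6 & uniq [:: a; b; d].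
Proof.
move=> ab; have [d /and3P[d6 ad bd]] : exists d, [&& d < 6, a != d & b != d].
  case: (boolP ((a == 0) || (b == 0))) => [h0|]; last first.
    by rewrite negb_or => /andP[*]; exists 0; apply/and3P.
  case: (boolP ((a == 1) || (b == 1))) => [h1|]; last first.
    by rewrite negb_or => /andP[*]; exists 1; apply/and3P.
  by exists 2; lia.
by exists d => //; rewrite /= !inE !negb_or ab ad bd.
Qed.

Lemma frame_inj a b c : a < 6 -> b < 6 -> c < 6 -> uniq [:: a; b; c] ->
  injective (frame (pt a) (pt b) (pt c)).
Proof.
move=> a6 b6 c6; rewrite /= !inE !negb_or => /and3P[/andP[ab ac] bc _].
have vE (x : 'I_n) : frame (pt a) (pt b) (pt c) x =
    nth (x + 3) [:: a; b; c] x :> nat.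
  rewrite /frame -!val_eqE; case: x => [[|[|[|x]]] hx] /=; rewrite ?(val_pt a6) ?(val_pt b6) ?(val_pt c6) //.
  by rewrite inordK ?nth_nil //=; move: hx; lia.
move=> x y /(congr1 val) /=; rewrite !vE => e; apply: val_inj => /=.
by move: e; case: x => [[|[|[|x]]] hx] /=; case: y => [[|[|[|y]]] hy] /=; rewrite ?nth_nil; lia.
Qed.

Lemma realizes_inj s t : V s -> realizes s t -> injective s -> injective (t : 'I_n -> nat).
Proof.
by move=> Vs st si a b e; apply: si; have /st/F_eq[] : sat t (Eq a b) by [].
Qed.

Lemma word_inj t x y : injective (t : 'I_n -> nat) -> x != y -> x \notin params -> y \notin params ->
  uniq (map (t : 'I_n -> nat) [:: x, y & params]).
Proof. by move=> ti xy xt yt; rewrite map_inj_uniq //= inE negb_or xy xt yt uniq_params. Qed.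

Lemma explicit_edge t x y : explicit_on finset.setT t -> injective (t : 'I_n -> nat) ->
  x != y -> x \notin params -> y \notin params ->
  exists c, sat t (edge c x y) /\ chi k (map t [:: x, y & params]) = (c.1, Some c.2).
Proof.
move=> ex ti xy xt yt; have u := word_inj ti xy xt yt.
have := ex [:: x, y & params] _ _ u; case E: (chi k _) => [i [r|]] h.
  by exists (i, r); split=> //; apply/sat_edge.
suff : explicit (i, None) by [].
apply: h; first by apply/allP => a _; exact: finset.in_setT.
by rewrite /= size_params.
Qed.

(** On an injective tuple whose range is a clique, the colour of an edge does not
    depend on the third point used to read it, and it is read consistently from
    all positions; so the six first points carry a coherent explicit
    colouring. *)
Section Clique.
Variable S : 'I_m -> M.
Hypothesis S_clique : Cm f S.
Hypothesis S_inj : injective S.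

Let tuple a b c := S \o frame (pt a) (pt b) (pt c).

Let V_tuple a b c : a < 6 -> b < 6 -> c < 6 -> uniq [:: a; b; c] ->
  V (tuple a b c) /\ injective (tuple a b c).
Proof.
move=> a6 b6 c6 u; have inj : injective (tuple a b c).
  by apply: inj_comp => //; apply: frame_inj.
by split=> //; apply: S_clique => // _ [x _ <-]; exists (frame (pt a) (pt b) (pt c) x).
Qed.

Let colour_of a b (c : 'I_3 * shade) :=
  forall d, d < 6 -> uniq [:: a; b; d] -> F (edge c o0 o1) (tuple a b d).

Let colour_any a b d c : a < 6 -> b < 6 -> d < 6 -> uniq [:: a; b; d] ->
  F (edge c o0 o1) (tuple a b d) -> colour_of a b c.
Proof.
move=> a6 b6 d6 u e d' d6' u'; have [V' _] := V_tuple a6 b6 d6' u'.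
exact: edge_agree (F_unit e) V' (frame_off2 _ _ _ _ _) o2_edge e.
Qed.

Let colour_uniq a b c c' : a < 6 -> b < 6 -> a != b -> colour_of a b c -> colour_of a b c' -> c = c'.
Proof.
move=> a6 b6 ab h h'.
have [d d6 u] := third_point ab.
have [Vs _] := V_tuple a6 b6 d6 u; have [t _ st] := V_realizes Vs.
have /st/sat_edge[_ e] := h d d6 u; have /st/sat_edge[_ ] := h' d d6 u; rewrite e.
by case: c c' {h h' e} => [i r] [i' r'] [-> ->].
Qed.

Lemma clique_colours : exists cc : nat -> nat -> colour,
  [/\ forall a b, a < 6 -> b < 6 -> a != b -> explicit (cc a b) /\ cc b a = conv (cc a b),
    forall a b c, a < 6 -> b < 6 -> c < 6 -> uniq [:: a; b; c] ->
      triangle (cc a b) (cc b c) (cc c a)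
  & forall a l, 1 < a < 6 -> F (cone l) (tuple 0 1 a) ->
      cc a 0 = (i0, Some (0, l)) /\ cc 1 a = (i1, Some (0, l))].
Proof.
have tl0 : o0 \notin params by rewrite mem_params.
have tl1 : o1 \notin params by rewrite mem_params.
have tl2 : o2 \notin params by rewrite mem_params.
have /boolp.choice[cc' ccP] (ab : nat * nat) : exists c, ab.1 < 6 -> ab.2 < 6 ->
    (exists2 d, d < 6 & uniq [:: ab.1; ab.2; d]) -> colour_of ab.1 ab.2 c.
  have [[a6 [b6 [d d6 u]]]|no] := pselect (ab.1 < 6 /\ ab.2 < 6 /\
    exists2 d, d < 6 & uniq [:: ab.1; ab.2; d]); last first.
    by exists (i0, (0, (false, false, false))) => *; case: no.
  have [Vs inj] := V_tuple a6 b6 d6 u; have [t ex st] := V_realizes Vs.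
  have [c [tc _]] := explicit_edge ex (realizes_inj Vs st inj) (isT : o0 != o1) tl0 tl1.
  by exists c => _ _ _; apply: colour_any d6 u _ => //; apply/st.
pose cc a b : colour := ((cc' (a, b)).1, Some (cc' (a, b)).2).
have ccE a b c : a < 6 -> b < 6 -> (exists2 d, d < 6 & uniq [:: a; b; d]) ->
    colour_of a b c -> cc a b = (c.1, Some c.2).
  move=> a6 b6 d h; have hh := ccP (a, b) a6 b6 d.
  rewrite /cc (colour_uniq a6 b6 _ hh h) //.
  by case: d => d _ /=; rewrite !inE negb_or => /and3P[/andP[]].
have main a b d t : a < 6 -> b < 6 -> d < 6 -> uniq [:: a; b; d] ->
    explicit_on finset.setT t -> realizes (tuple a b d) t ->
    [/\ injective (t : 'I_n -> nat), chi k (map t [:: o0, o1 & params]) = cc a b,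
      chi k (map t [:: o1, o2 & params]) = cc b d, chi k (map t [:: o2, o0 & params]) = cc d a
      & chi k (map t [:: o1, o0 & params]) = cc b a].
  move=> a6 b6 d6 u ex st; have [Vs inj] := V_tuple a6 b6 d6 u.
  have ti := realizes_inj Vs st inj; split=> //.
  - have [c [/st e ->]] := explicit_edge ex ti (isT : o0 != o1) tl0 tl1.
    by rewrite (ccE a b c) //; [exists d|apply: colour_any e].
  - have u' : uniq [:: b; d; a] by rewrite -(rot_uniq 2).
    have [V' _] := V_tuple b6 d6 a6 u'.
    have [c [/st e ->]] := explicit_edge ex ti (isT : o1 != o2) tl1 tl2.
    by rewrite (ccE b d c) //; [exists a|apply: colour_any (edge_rot1 V' e)].
  - have u' : uniq [:: d; a; b] by rewrite -(rot_uniq 1).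
    have [V' _] := V_tuple d6 a6 b6 u'.
    have [c [/st e ->]] := explicit_edge ex ti (isT : o2 != o0) tl2 tl0.
    by rewrite (ccE d a c) //; [exists b|apply: colour_any (edge_rot2 V' e)].
  - have u' : uniq [:: b; a; d] by move: u; rewrite /= !inE !negb_or eq_sym => /and3P[/andP[-> ->] ->].
    have [V' _] := V_tuple b6 a6 d6 u'.
    have [c [/st e ->]] := explicit_edge ex ti (isT : o1 != o0) tl1 tl0.
    by rewrite (ccE b a c) //; [exists d|apply: colour_any (edge_swap V' e)].
have [chi1 chi2] := chi_coherent k.
have allT (w : seq nat) : all predT w by apply/allP.
exists cc; split=> [a b a6 b6 ab|a b d a6 b6 d6 u|a l /andP[a1 a6] g].
- split=> //.
  have [d d6 u] := third_point ab.
  have [Vs inj] := V_tuple a6 b6 d6 u; have [t ex st] := V_realizes Vs.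
  have [ti <- _ _ <-] := main a b d t a6 b6 d6 u ex st.
  by apply: chi1; rewrite ?size_map ?size_params // -!map_cons word_inj.
- have [Vs inj] := V_tuple a6 b6 d6 u; have [t ex st] := V_realizes Vs.
  have [ti <- <- <- _] := main a b d t a6 b6 d6 u ex st.
  apply: chi2; rewrite ?size_map ?size_params // -!map_cons map_inj_uniq //.
  by rewrite -enum_n enum_uniq.
have u : uniq [:: 0; 1; a] by rewrite /= !inE; lia.
have [Vs inj] := V_tuple (isT : 0 < 6) (isT : 1 < 6) a6 u; have [t ex st] := V_realizes Vs.
have [_ _ <- <- _] := main 0 1 a t isT isT a6 u ex st.
by have /st[/sat_edge[_ ->] /sat_edge[_ ->]] := g.
Qed.
End Clique.

(** * Squareness builds four cones *)

Section Build.
Hypothesis sq : square f m.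

Definition tint (a : nat) : label := (odd a, odd a./2, false).

Lemma tint_inj a b : 1 < a < 6 -> 1 < b < 6 -> tint a = tint b -> a = b.
Proof.
by case: a => [|[|[|[|[|[|a]]]]]] // _; case: b => [|[|[|[|[|[|b]]]]]] // _ [].
Qed.

(** The tuple only provides k + 2 distinct points in the unit.  Whether its range is a
    clique is unknown. *)
Lemma base_tuple : exists s0 (t0 : 'I_n -> model k), [/\ V s0, realizes s0 t0 &
  uniq (map (t0 : 'I_n -> nat) [:: o0, o1 & params])].
Proof.
have [t [e _] ex] := @explicit_dense k 0 (@nat_of_ord n).
have ti : injective t.
  move=> a b tab; apply: val_inj; apply/eqP.
  by rewrite (e a b) ?finset.in_setT // tab.
have [||c [tc _]] := explicit_edge ex ti (isT : o0 != o1); rewrite ?mem_params //.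
have [s es] : exists s, F (edge c o0 o1) s.
  apply: contrapT => no; suff /class_bot/(_ t) : Fm_class T (edge c o0 o1) = \bot%O by [].
  apply: (rep_inj rep); rewrite (rep_bot rep); apply/seteqP; split=> // s es.
  by case: no; exists s.
have [t0 _ st0] := V_realizes (F_unit es).
by exists s, t0; split; [exact: F_unit es | | have /st0/sat_edge[] := es].
Qed.

Section Base.
Variables (s0 : 'I_n -> M) (t0 : 'I_n -> model k).
Hypothesis Vs0 : V s0.
Hypothesis st0 : realizes s0 t0.
Hypothesis ut0 : uniq (map (t0 : 'I_n -> nat) [:: o0, o1 & params]).

Let base_frame z := frame (pt 0) (pt 1) z.

(** The invariant: k + 2 base points, apexes at the positions from 2 to [a - 1], and
    copies of the base point [s0 o1] at the positions reserved for later
    apexes. *)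
Let built a S := [/\ Cm f S,
  forall z x, x != o2 -> S (base_frame z x) = s0 x,
  forall z, 1 < z < a -> F (cone (tint z)) (S \o base_frame (pt z))
  & forall z, a <= z < 6 -> S (pt z) = s0 o1].

(** With fewer than n points there is nothing to check for a clique. *)
Lemma built2 : exists S, built 2 S.
Proof.
pose S (j : 'I_m) := if j == 0 :> nat then s0 o0 else if j < 6 then s0 o1 else s0 (inord (j - 3)).
exists S; split.
- move=> s si sS.
  have Sr j : exists2 x, x != o2 & S j = s0 x.
    rewrite /S; case: eqP => [_|_]; first by exists o0.
    case: ltnP => [_|j6]; first by exists o1.
    exists (inord (j - 3)) => //; rewrite -val_eqE /= inordK; last by have := ltn_ord j; lia.
    by lia.
  have /boolp.choice[g gP] y : exists x, x != o2 /\ s y = s0 x.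
    have [j _ <-] := sS (s y) (ex_intro2 _ _ y Logic.I erefl).
    by have [x ? ->] := Sr j; exists x.
  have gi : injective g by move=> y y' e; apply: si; rewrite !(gP _).2 e.
  have [h _ hK] := injF_bij gi.
  by have [] := gP (h o2); rewrite hK eqxx.
- move=> z x x2; rewrite /base_frame /frame; case: eqP => [->|/eqP x0].
    by rewrite /S val_pt.
  case: eqP => [->|/eqP x1]; first by rewrite /S val_pt.
  rewrite (negbTE x2) /S; have x3 : 2 < x.
    by move: x0 x1 x2; rewrite -!val_eqE /=; lia.
  have e : (inord (x + 3) : 'I_m) = x + 3 :> nat by rewrite inordK //; have := ltn_ord x; lia.
  rewrite e; have -> : (x + 3 == 0) = false by lia.
  have -> : (x + 3 < 6) = false by lia.
  by rewrite addnK inord_val.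
- by move=> z; lia.
- by move=> z /andP[z2 z6]; rewrite /S val_pt // z6; case: eqP => // z0; rewrite z0 in z2.
Qed.

(** Before the step the frame at position [a] is a base tuple with a repetition, which
    lies in the unit and has a cone over it by [cone_extension]. *)
Lemma builtS a S : 1 < a < 6 -> built a S -> exists S', built a.+1 S'.
Proof.
move=> /andP[a1 a6] [CS Sb Sg Sj]; pose l := base_frame (pt a).
have li : injective l by apply: frame_inj => //; rewrite /= !inE; lia.
have l2 : l o2 = pt a by [].
have Sl : S \o l = upd s0 o2 (s0 o1).
  apply/funext => x; rewrite /upd /=; case: eqP => [->|/eqP x2]; last exact: Sb.
  by rewrite l2 Sj // leqnn.
have [V1 st1] := V_upd Vs0 st0 (isT : o2 != o1).
have ext : F (Ex o2 (cone (tint a))) (S \o l).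
  rewrite Sl; apply/st1/cone_extension; rewrite (_ : map _ _ = map t0 [:: o0, o1 & params]) //.
  apply/eq_in_map => x xw; rewrite /upd; case: eqP => // x2.
  by have := o2_edge; rewrite -x2 xw.
rewrite class_cyl in ext; have [S' [CS' SS' gS']] := sq.2 S _ o2 l CS li ext.
rewrite l2 in SS'.
have off z x : x != o2 -> base_frame z x != pt a.
  move=> x2; have -> : base_frame z x = l x by rewrite /l /base_frame /frame (negbTE x2).
  by rewrite -l2 (inj_eq li).
have offz z : 1 < z < 6 -> z != a -> pt z != pt a.
  by move=> /andP[_ z6]; rewrite -val_eqE /= !val_pt.
exists S'; split=> //.
- by move=> z x x2; rewrite SS' ?Sb // off.
- move=> z /andP[z1 za]; have [->//|za'] := eqVneq z a.
  have za2 : z < a by lia.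
  suff -> : S' \o base_frame (pt z) = S \o base_frame (pt z) by apply: Sg; rewrite z1.
  apply/funext => x /=; apply: SS'; have [->|] := eqVneq x o2; last exact: off.
  by apply: offz; lia.
- move=> z /andP[za z6]; rewrite SS' ?Sj //; first by lia.
  by apply: offz; lia.
Qed.

Lemma built6 : exists S, built 6 S.
Proof.
have [S S2] := built2; have [{S2}S S3] := builtS (isT : 1 < 2 < 6) S2.
have [{S3}S S4] := builtS (isT : 1 < 3 < 6) S3.
have [{S4}S S5] := builtS (isT : 1 < 4 < 6) S4.
exact: builtS S5.
Qed.

(** An apex differs from the base points because the edges of its cone exist, and two
    apexes at the same point would have equal tints. *)
Lemma built6_inj S : built 6 S -> injective S.
Proof.
move=> [CS Sb Sg _].
have real z : 1 < z < 6 -> exists t, realizes (S \o base_frame (pt z)) t.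
  by move=> /Sg /F_unit /V_realizes[t _ ?]; exists t.
have s01 : s0 o0 <> s0 o1.
  move=> e; have /st0 /= e' : F (Eq o0 o1) s0 by apply/F_eq.
  by move: ut0; rewrite /= e' inE eqxx.
have inj z : 1 < z < 6 -> injective (S \o base_frame (pt z)).
  move=> hz; have [t st] := real z hz; have g := Sg z hz; have Vz := F_unit g.
  have /st[/sat_edge[u1 _] /sat_edge[u2 _]] := g.
  have t01 : t o0 <> t o1.
    by move=> e; have /st/F_eq[_] : sat t (Eq o0 o1) by []; rewrite /= !Sb.
  have ti : injective (t : 'I_n -> nat).
    apply/injectiveP; rewrite /injectiveb /dinjectiveb enum_n /=.
    move: u1 u2 => /=; rewrite !inE !negb_or => /and3P[/andP[t20 t2] t0' ut] /and3P[/andP[t12 t1] _ _].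
    by rewrite t1 t2 t0' ut [t o0 == t o2]eq_sym t20 t12 !andbT; apply/eqP.
  move=> x y e; apply: ti; have /st := (F_eq x y _).2 (conj Vz e).
  by [].
have cov z (j : 'I_m) : 1 < z < 6 -> j = z :> nat \/ ~~ (1 < j < 6) ->
    exists x, base_frame (pt z) x = j.
  move=> /andP[z1 z6] [jz|j6].
    by exists o2; apply: val_inj; rewrite /= val_pt.
  have [j0|j0] := eqVneq (j : nat) 0; first by exists o0; apply: val_inj; rewrite /= val_pt.
  have [j1|j1] := eqVneq (j : nat) 1; first by exists o1; apply: val_inj; rewrite /= val_pt.
  have jm := ltn_ord j; exists (inord (j - 3)); apply: val_inj.
  have e : (inord (j - 3) : 'I_n) = j - 3 :> nat by rewrite inordK //; lia.
  rewrite /base_frame /frame -!val_eqE /= e.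
  have -> : (j - 3 == 0) = false by lia.
  have -> : (j - 3 == 1) = false by lia.
  have -> : (j - 3 == 2) = false by lia.
  by rewrite inordK; lia.
move=> j j' e.
have [hj|hj] := boolP (1 < j < 6); have [hj'|hj'] := boolP (1 < j' < 6).
- apply: val_inj; apply: tint_inj => //.
  have eS : S \o base_frame (pt j) = S \o base_frame (pt j').
    apply/funext => x /=; have [->|x2] := eqVneq x o2; last by rewrite !Sb.
    by rewrite /base_frame /frame /= /pt !inord_val.
  have [t st] := real _ hj'.
  have := Sg _ hj; rewrite eS => /st[/sat_edge[_ e1] _].
  have /st[/sat_edge[_]] := Sg _ hj'; rewrite e1.
  by move/(congr1 (fun c : colour => (odflt (0, tint 0) c.2).2)).
- have [x xj] := cov j j hj (or_introl erefl); have [x' xj'] := cov j j' hj (or_intror hj').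
  have xx : x = x' by apply: (inj _ hj); rewrite /= xj xj'.
  by rewrite -[LHS]xj -[RHS]xj' xx.
- have [x xj] := cov j' j hj' (or_intror hj); have [x' xj'] := cov j' j' hj' (or_introl erefl).
  have xx : x = x' by apply: (inj _ hj'); rewrite /= xj xj'.
  by rewrite -[LHS]xj -[RHS]xj' xx.
- have [x xj] := cov 2 j isT (or_intror hj); have [x' xj'] := cov 2 j' isT (or_intror hj').
  have xx : x = x' by apply: (inj 2 isT); rewrite /= xj xj'.
  by rewrite -[LHS]xj -[RHS]xj' xx.
Qed.
End Base.

Theorem no_square_omitting : False.
Proof.
have [s0 [t0 [Vs0 st0 ut0]]] := base_tuple.
have [S S6] := built6 Vs0 st0 ut0; have Si := built6_inj Vs0 st0 ut0 S6.
have [CS _ Sg _] := S6; have [cc [c1 c2 c3]] := clique_colours CS Si.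
apply: (no_four_cones c1 c2) => a ha; exists (tint a).
exact: c3 (Sg a ha).
Qed.
End Build.
End Configuration.
End Representation.

Theorem corollary4p15 (n : nat) (hn : (2 < n)%N) :
  exists (L : signature) (T : theory L n),
    [/\ countable_theory T, atomic_theory T & complete_theory T] /\
    [/\ nonprincipal T (coatoms T),
        forall (M : Type) (f : Fm T -> set ('I_n -> M)),
          square_model (n + 3) f -> ~ omits f (coatoms T)
      & forall (M : Type) (f : Fm T -> set ('I_n -> M)),
          flat_model (n + 3) f -> ~ omits f (coatoms T)].
Proof.
case: n hn => [|[|[|k]]] // _.
exists (lang k), (@Th (lang k) k.+3 (model k)); split.
  by split; [exact: lang_countable | exact: Th_atomic | exact: Th_complete].
have no_square (M : Type) (f : Fm (Th (model k)) -> set ('I_k.+3 -> M)) :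
    square_model (k.+3 + 3) f -> ~ omits f (coatoms (Th (model k))).
  by rewrite addn3 => sq om; exact: (no_square_omitting sq.1 om sq).
split=> //; first by apply: coatoms_nonprincipal; exact: Th_atomic.
by move=> M f [sq _]; exact: no_square.
Qed.
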